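(* Let $\mathcal{G}$ be an ultragraph. If $(H,B)$ is an admissible pair in $\mathcal{G}$, then $C^*(\mathcal{G}/(H,B))\cong C^*(\mathcal{G})/I_{(H,B)}$.
   Context: An ultragraph $\mathcal{G}=(G^0,\mathcal{G}^1,r_{\mathcal{G}},s_{\mathcal{G}})$ consists of a countable vertex set $G^0$, a countable edge set $\mathcal{G}^1$, a source map $s_{\mathcal{G}}:\mathcal{G}^1\to G^0$ and a range map $r_{\mathcal{G}}:\mathcal{G}^1\to\mathcal{P}(G^0)\setminus\{\emptyset\}$. $\mathcal{G}^0$ denotes the smallest subcollection of $\mathcal{P}(G^0)$ containing all singletons $\{v\}$ ($v\in G^0$) and all $r_{\mathcal{G}}(e)$ ($e\in\mathcal{G}^1$) and closed under $\cap,\cup,\setminus$. Singletons $\{v\}$ are written $v$ (so $v\in H$ means $\{v\}\in H$). A Cuntz-Krieger $\mathcal{G}$-family is a set of partial isometries $\{s_e:e\in\mathcal{G}^1\}$ with mutually orthogonal ranges and projections $\{p_A:A\in\mathcal{G}^0\}$ such that: $p_\emptyset=0$, $p_Ap_B=p_{A\cap B}$, $p_{A\cup B}=p_A+p_B-p_{A\cap B}$; $s_e^*s_e=p_{r_{\mathcal{G}}(e)}$; $s_es_e^*\le p_{s_{\mathcal{G}}(e)}$; and $p_v=\sum_{s_{\mathcal{G}}(e)=v}s_es_e^*$ whenever $0<|s_{\mathcal{G}}^{-1}(v)|<\infty$. $C^*(\mathcal{G})$ is the $C^*$-algebra generated by a universal Cuntz-Krieger $\mathcal{G}$-family $\{s_e,p_A\}$.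 A subset $H\subseteq\mathcal{G}^0$ (with $\emptyset\in H$) is hereditary if: $s_{\mathcal{G}}(e)\in H$ implies $r_{\mathcal{G}}(e)\in H$ for all $e\in\mathcal{G}^1$; $A,B\in H$ implies $A\cup B\in H$; and $A\in H$, $B\in\mathcal{G}^0$, $B\subseteq A$ imply $B\in H$. It is saturated if for every $v\in G^0$ with $0<|s_{\mathcal{G}}^{-1}(v)|<\infty$, $\{r_{\mathcal{G}}(e):s_{\mathcal{G}}(e)=v\}\subseteq H$ implies $v\in H$. For $H$ saturated hereditary, the set of breaking vertices is $B_H:=\{w\in G^0:|s_{\mathcal{G}}^{-1}(w)|=\infty$ but $0<|\{e\in s_{\mathcal{G}}^{-1}(w):r_{\mathcal{G}}(e)\notin H\}|<\infty\}$. An admissible pair $(H,B)$ is a saturated hereditary $H\subseteq\mathcal{G}^0$ with a subset $B\subseteq B_H$. $I_{(H,B)}$ is the (closed two-sided) ideal of $C^*(\mathcal{G})$ generated by $\{p_A:A\in H\}\cup\{p_w^H:w\in B\}$, where $p_w^H:=p_w-\sum_{s_{\mathcal{G}}(e)=w,\,r_{\mathcal{G}}(e)\notin H}s_es_e^*$. Given an admissible pair $(H,B)$, the extended ultragraph $\overline{\mathcal{G}}$ has vertex set $\overline{G}^0:=G^0\cup\{w':w\in B_H\setminus B\}$ (the $w'$ being new vertices), edge set $\overline{\mathcal{G}}^1:=\mathcal{G}^1$, source map $\overline{s}_{\mathcal{G}}(e):=(s_{\mathcal{G}}(e))'$ if $s_{\mathcal{G}}(e)\in B_H\setminus B$ and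 $r_{\mathcal{G}}(e)\in H$, $\overline{s}_{\mathcal{G}}(e):=s_{\mathcal{G}}(e)$ otherwise, and range map $\overline{r}_{\mathcal{G}}(e):=\overline{r_{\mathcal{G}}(e)}$, where $\overline{A}:=A\cup\{w':w\in A\cap(B_H\setminus B)\}$ for $A\in\mathcal{G}^0$. $\overline{\mathcal{G}}^0$ is the algebra of sets generated by the singletons of $\overline{G}^0$ and the sets $\overline{r}_{\mathcal{G}}(e)$. (Note $\overline A=A$ for $A\in H$, so $H\subseteq\overline{\mathcal G}^0$.) On $\overline{\mathcal{G}}^0$ put $A\sim B$ iff there is $V\in H$ with $A\cup V=B\cup V$ (equivalently $A\setminus B,B\setminus A\in H$); this is an equivalence relation and $[A]\cup[B]:=[A\cup B]$, $[A]\cap[B]:=[A\cap B]$, $[A]\setminus[B]:=[A\setminus B]$ are well defined on classes. The quotient ultragraph is $\mathcal{G}/(H,B)=(\Phi(G^0),\Phi(\mathcal{G}^0),\Phi(\mathcal{G}^1),r,s)$ with vertices $\Phi(G^0):=\{[v]:v\in G^0,\ v\notin H\}\cup\{[w']:w\in B_H\setminus B\}$, $\Phi(\mathcal{G}^0):=\{[A]:A\in\overline{\mathcal{G}}^0\}$, edges $\Phi(\mathcal{G}^1):=\{e\in\overline{\mathcal{G}}^1:\overline{r}_{\mathcal{G}}(e)\notin H\}$, $r(e):=[\overline{r}_{\mathcal{G}}(e)]$, $s(e):=[\overline{s}_{\mathcal{G}}(e)]$. A representation of $\mathcal{G}/(H,B)$ is a set of partial isometries $\{T_e:e\in\Phi(\mathcal{G}^1)\}$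 and projections $\{Q_{[A]}:[A]\in\Phi(\mathcal{G}^0)\}$ such that (QA1) $Q_{[\emptyset]}=0$, $Q_{[A\cap B]}=Q_{[A]}Q_{[B]}$, $Q_{[A\cup B]}=Q_{[A]}+Q_{[B]}-Q_{[A\cap B]}$; (QA2) $T_e^*T_e=Q_{r(e)}$ and $T_e^*T_f=0$ when $e\neq f$; (QA3) $T_eT_e^*\leq Q_{s(e)}$; (QA4) $Q_{[v]}=\sum_{s(e)=[v]}T_eT_e^*$ for $[v]\in\Phi(G^0)$ with $0<|s^{-1}([v])|<\infty$. $C^*(\mathcal{G}/(H,B))$ is the universal $C^*$-algebra generated by a representation $\{t_e,q_{[A]}\}$. *)

(* Defs.v *)
From HB Require Import structures.
From mathcomp Require Import all_boot all_order all_algebra.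
From mathcomp Require Import generic_quotient ring_quotient complex.
From mathcomp Require Import mathcomp_extra boolp classical_sets functions.
From mathcomp Require Import cardinality fsbigop reals topology normedtype.

Set Implicit Arguments.
Unset Strict Implicit.
Unset Printing Implicit Defensive.

Import Order.TTheory GRing.Theory Num.Theory.
Import numFieldNormedType.Exports.

Local Open Scope classical_set_scope.
Local Open Scope ring_scope.
Local Open Scope quotient_scope.

(* Complex *-algebras need not be unital, so the ring structures of MathComp,
   which all carry a 1, do not apply. *)
HB.mixin Record Lmodule_isStarAlgebra (R : realType) A
    of GRing.Lmodule R[i] A := {
  amul : A -> A -> A;
  star : A -> A;
  amulA : associative amul;
  amulDl : left_distributive amul +%R;
  amulDr : right_distributive amul +%R;
  amulZl : forall (k : R[i]) x y, amul (k *: x) y = k *: amul x y;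
  amulZr : forall (k : R[i]) x y, amul x (k *: y) = k *: amul x y;
  starD : {morph star : x y / x + y};
  starZ : forall (k : R[i]) x, star (k *: x) = k^* *: star x;
  starK : involutive star;
  starM : forall x y, star (amul x y) = amul (star y) (star x)
}.

#[short(type="starAlgType")]
HB.structure Definition StarAlgebra (R : realType) :=
  {A of GRing.Lmodule R[i] A & Lmodule_isStarAlgebra R A}.

HB.mixin Record StarAlgebra_isCStar (R : realType) A
    of CompleteNormedModule R[i] A & StarAlgebra R A := {
  ler_norm_amul : forall x y : A, `|amul x y| <= `|x| * `|y|;
  cstar_identity : forall x : A, `|amul (star x) x| = `|x| ^+ 2
}.

#[short(type="cstarAlgType")]
HB.structure Definition CStarAlgebra (R : realType) :=
  {A of CompleteNormedModule R[i] A & StarAlgebra R A & StarAlgebra_isCStar R A}.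

Declare Scope cstar_scope.
Delimit Scope cstar_scope with cstar.
Local Open Scope cstar_scope.
Notation "x ** y" := (amul x y) (at level 40, left associativity) : cstar_scope.
Notation "x ^#" := (star x) (at level 2, format "x ^#") : cstar_scope.

Section StarAlgebraTheory.
Context {R : realType} {A B : starAlgType R}.

Definition star_hom (f : A -> B) : Prop :=
  [/\ linear f, {morph f : x y / x ** y} & {morph f : x / x^#}].

Definition projection (p : A) : Prop := p^# = p /\ p ** p = p.

Definition partial_isometry (s : A) : Prop := s ** s^# ** s = s.

Definition range_projection (s : A) : A := s ** s^#.

(* This is the order p <= q on projections, in any *-algebra. *)
Definition subprojection (p q : A) : Prop := p ** q = p.

Lemma amul0x (x : A) : 0 ** x = 0.
Proof. by rewrite -(scale0r x) amulZl !scale0r. Qed.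

Lemma amulx0 (x : A) : x ** 0 = 0.
Proof. by rewrite -(scale0r x) amulZr !scale0r. Qed.

Lemma star0 : (0 : A)^# = 0.
Proof. by rewrite -(scale0r 0) starZ rmorph0 !scale0r. Qed.

Lemma starN (x : A) : (- x)^# = - x^#.
Proof. by rewrite -scaleN1r starZ rmorphN1 scaleN1r. Qed.

Lemma amulBl (x y z : A) : (x - y) ** z = x ** z - y ** z.
Proof. by rewrite amulDl -(scaleN1r y) amulZl scaleN1r. Qed.

Lemma amulBr (x y z : A) : x ** (y - z) = x ** y - x ** z.
Proof. by rewrite amulDr -(scaleN1r z) amulZr scaleN1r. Qed.

End StarAlgebraTheory.

Section CStarAlgebraTheory.
Context {R : realType} {A : cstarAlgType R}.

Definition closed_star_subalgebra (M : set A) : Prop :=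
  [/\ closed M, M 0,
      (forall (k : R[i]) x y, M x -> M y -> M (k *: x + y)),
      (forall x y, M x -> M y -> M (x ** y))
    & (forall x, M x -> M x^#)].

Definition generates (S : set A) : Prop :=
  smallest closed_star_subalgebra S = setT.

Definition closed_ideal (J : set A) : Prop :=
  [/\ closed J, J 0,
      (forall (k : R[i]) x y, J x -> J y -> J (k *: x + y))
    & (forall a x, J x -> J (a ** x) /\ J (x ** a))].

Definition ideal_generated (S : set A) : set A := smallest closed_ideal S.

Lemma closed_ideal_generated (S : set A) : closed_ideal (ideal_generated S).
Proof.
split.
- by apply: closed_bigI => J [[]].
- by move=> J [[]].
- by move=> k x y Jx Jy J HJ; case: (HJ) => -[_ _ + _] _; apply;
    [exact: Jx | exact: Jy].
- by move=> a x Jx; split=> J HJ; case: (HJ) => -[_ _ _ +] _ => /(_ a x (Jx J HJ)) [].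
Qed.

Lemma norm_star (x : A) : `|x^#| = `|x|.
Proof.
have le y : `|y| <= `|y^# : A|.
  have [->|y0] := eqVneq y 0; first by rewrite star0.
  rewrite -(ler_pM2r (_ : 0 < `|y|)) ?normr_gt0// -expr2 -cstar_identity.
  exact: ler_norm_amul.
by apply/eqP; rewrite eq_le le andbT -{2}(starK x) le.
Qed.

Lemma continuous_star : continuous (star : A -> A).
Proof.
move=> x; apply/cvgrPdist_lt => e e0; near=> y.
rewrite -starN -starD norm_star; near: y.
exact: cvgr_dist_lt.
Unshelve. all: by end_near. Qed.

Lemma ideal_generated_star (S : set A) : (forall x, S x -> S x^#) ->
  forall x, ideal_generated S x -> ideal_generated S x^#.
Proof.
move=> SS x + J [[Jc J0 JD JM] SJ] => /(_ (star @^-1` J)); apply; split; last first.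
  by move=> y /SS /SJ.
split => /=.
- by apply: preimage_closed => // y _; exact: continuous_star.
- by rewrite /preimage/= star0.
- by move=> k y z /= Jy Jz; rewrite starD starZ; exact: JD.
- by move=> a y /= Jy; rewrite !starM; have [? ?] := JM a^# _ Jy.
Qed.

End CStarAlgebraTheory.

(* A closed two-sided ideal of a C*-algebra is automatically self-adjoint; the
   field [sideal_star] records it, so that the quotient has an involution. *)
Record sideal (R : realType) (A : cstarAlgType R) := SIdeal {
  sideal_set :> set A;
  sideal_closed_ideal : closed_ideal sideal_set;
  sideal_star : forall x, sideal_set x -> sideal_set x^#
}.

Section Quotient.
Context {R : realType} {A : cstarAlgType R} (J : sideal A).

Definition sideal_pred : {pred A} := [pred x | x \in (J : set A)].

Lemma sideal_predP x : reflect (sideal_set J x) (x \in sideal_pred).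
Proof.
rewrite unfold_in /=; apply: (iffP idP) => [/set_mem//|Jx]; exact: mem_set.
Qed.

Lemma sideal_zmod_closed : zmod_closed sideal_pred.
Proof.
have [_ J0 JD _] := sideal_closed_ideal J.
split; first exact/sideal_predP.
move=> x y /sideal_predP Jx /sideal_predP Jy; apply/sideal_predP.
by rewrite addrC -scaleN1r; exact: JD.
Qed.

HB.instance Definition _ :=
  GRing.isZmodClosed.Build A sideal_pred sideal_zmod_closed.

Definition quotient : Type := Quotient.quot sideal_pred.
HB.instance Definition _ := GRing.Zmodule.on quotient.
HB.instance Definition _ : EqQuotient A (Quotient.equiv sideal_pred) quotient :=
  EqQuotient.on quotient.

Definition qproj (x : A) : quotient := \pi_quotient x.

Lemma qproj_surj (u : quotient) : exists x, qproj x = u.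
Proof. by exists (repr u); rewrite /qproj reprK. Qed.

Lemma qproj_eqP (x y : A) : qproj x = qproj y <-> sideal_set J (x - y).
Proof.
rewrite (rwP (sideal_predP (x - y))) (Quotient.idealrBE sideal_pred).
by split=> /eqP.
Qed.

Lemma qprojD : {morph qproj : x y / x + y}.
Proof. exact: (Quotient.pi_add sideal_pred). Qed.

Definition qscale (k : R[i]) (u : quotient) : quotient := qproj (k *: repr u).
Definition qmul (u v : quotient) : quotient := qproj (repr u ** repr v).
Definition qstar (u : quotient) : quotient := qproj (repr u)^#.

Lemma repr_qproj x : sideal_set J (repr (qproj x) - x).
Proof. by apply/qproj_eqP; rewrite /qproj reprK. Qed.

Lemma qprojZ k x : qproj (k *: x) = qscale k (qproj x).
Proof.
apply/esym/qproj_eqP; rewrite -scalerBr -[_ *: _]addr0.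
have [_ J0 JD _] := sideal_closed_ideal J.
by apply: JD => //; exact: repr_qproj.
Qed.

Lemma qprojM x y : qproj (x ** y) = qmul (qproj x) (qproj y).
Proof.
apply/esym/qproj_eqP; have [_ J0 JD JM] := sideal_closed_ideal J.
set a := repr _; set b := repr _.
have -> : a ** b - x ** y = 1 *: (a ** (b - y)) + (a - x) ** y.
  by rewrite scale1r amulBr amulBl addrA addrNK.
apply: JD; first exact: (JM _ _ (repr_qproj y)).1.
exact: (JM _ _ (repr_qproj x)).2.
Qed.

Lemma qproj_star x : qproj x^# = qstar (qproj x).
Proof.
apply/esym/qproj_eqP; rewrite -starN -starD.
exact: sideal_star (repr_qproj x).
Qed.

Fact qscaleA (a b : R[i]) u : qscale a (qscale b u) = qscale (a * b) u.
Proof. by have [x <-] := qproj_surj u; rewrite -!qprojZ scalerA. Qed.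
Fact qscale1 : left_id 1 qscale.
Proof. by move=> u; have [x <-] := qproj_surj u; rewrite -qprojZ scale1r. Qed.
Fact qscaleDr : right_distributive qscale +%R.
Proof.
move=> k u v; have [x <-] := qproj_surj u; have [y <-] := qproj_surj v.
by rewrite -qprojD -!qprojZ -qprojD scalerDr.
Qed.
Fact qscaleDl u : {morph qscale^~ u : a b / a + b}.
Proof.
by move=> a b; have [x <-] := qproj_surj u; rewrite -!qprojZ -qprojD scalerDl.
Qed.

HB.instance Definition _ := GRing.Zmodule_isLmodule.Build R[i] quotient
  qscaleA qscale1 qscaleDr qscaleDl.

Lemma qproj_scale (k : R[i]) x : qproj (k *: x) = k *: qproj x.
Proof. exact: qprojZ. Qed.

Fact qmulA : associative qmul.
Proof.
move=> u v w; have [x <-] := qproj_surj u; have [y <-] := qproj_surj v.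
by have [z <-] := qproj_surj w; rewrite -!qprojM amulA.
Qed.
Fact qmulDl : left_distributive qmul +%R.
Proof.
move=> u v w; have [x <-] := qproj_surj u; have [y <-] := qproj_surj v.
by have [z <-] := qproj_surj w; rewrite -!(qprojD, qprojM) amulDl.
Qed.
Fact qmulDr : right_distributive qmul +%R.
Proof.
move=> u v w; have [x <-] := qproj_surj u; have [y <-] := qproj_surj v.
by have [z <-] := qproj_surj w; rewrite -!(qprojD, qprojM) amulDr.
Qed.
Fact qmulZl (k : R[i]) (u v : quotient) : qmul (k *: u) v = k *: qmul u v.
Proof.
have [x <-] := qproj_surj u; have [y <-] := qproj_surj v.
by rewrite -!(qproj_scale, qprojM) amulZl.
Qed.
Fact qmulZr (k : R[i]) (u v : quotient) : qmul u (k *: v) = k *: qmul u v.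
Proof.
have [x <-] := qproj_surj u; have [y <-] := qproj_surj v.
by rewrite -!(qproj_scale, qprojM) amulZr.
Qed.
Fact qstarD : {morph qstar : u v / u + v}.
Proof.
move=> u v; have [x <-] := qproj_surj u; have [y <-] := qproj_surj v.
by rewrite -!(qprojD, qproj_star) starD.
Qed.
Fact qstarZ (k : R[i]) (u : quotient) : qstar (k *: u) = k^* *: qstar u.
Proof.
by have [x <-] := qproj_surj u; rewrite -!(qproj_scale, qproj_star) starZ.
Qed.
Fact qstarK : involutive qstar.
Proof. by move=> u; have [x <-] := qproj_surj u; rewrite -!qproj_star starK. Qed.
Fact qstarM (u v : quotient) : qstar (qmul u v) = qmul (qstar v) (qstar u).
Proof.
have [x <-] := qproj_surj u; have [y <-] := qproj_surj v.
by rewrite -qprojM -!qproj_star -qprojM starM.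
Qed.

HB.instance Definition _ := Lmodule_isStarAlgebra.Build R quotient
  qmulA qmulDl qmulDr qmulZl qmulZr qstarD qstarZ qstarK qstarM.

(* The norm of a C*-algebra takes its values in the nonnegative elements of
   R[i]; the infimum is taken over their real parts. *)
Definition quotient_norm (u : quotient) : R :=
  inf [set complex.Re `|x| | x in [set x : A | qproj x = u]].

End Quotient.

Definition cstar_isomorphic_quotient (R : realType) (B A : cstarAlgType R)
    (J : sideal A) : Prop :=
  exists phi : B -> quotient J,
    [/\ star_hom phi, bijective phi
      & forall x : B, `|x| = (quotient_norm (phi x))%:C%C].

Record ultragraph := Ultragraph {
  vertex : countType;
  edge : countType;
  source : edge -> vertex;
  range : edge -> set vertex;
  range_neq0 : forall e, range e !=set0
}.

Section SetAlgebra.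
Variable G : ultragraph.

Definition closed_set_operations (F : set (set (vertex G))) : Prop :=
  [/\ F set0,
      (forall A B, F A -> F B -> F (A `&` B)),
      (forall A B, F A -> F B -> F (A `|` B))
    & (forall A B, F A -> F B -> F (A `\` B))].

(* [gset] is the collection usually written \mathcal{G}^0. Closure under set
   difference already yields set0, except when there is no vertex. *)
Definition gset : set (set (vertex G)) :=
  smallest closed_set_operations
    ([set [set v] | v in setT] `|` [set range e | e in setT]).

Definition out_edges (v : vertex G) : set (edge G) := [set e | source e = v].

Definition regular (v : vertex G) : Prop :=
  finite_set (out_edges v) /\ out_edges v !=set0.

Definition hereditary (H : set (set (vertex G))) : Prop :=
  [/\ (forall e, H [set source e] -> H (range e)),
      (forall A B, H A -> H B -> H (A `|` B))
    & (forall A B, H A -> gset B -> B `<=` A -> H B)].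

Definition saturated (H : set (set (vertex G))) : Prop :=
  forall v, regular v -> (forall e, source e = v -> H (range e)) -> H [set v].

Definition surviving_edges (H : set (set (vertex G))) (w : vertex G) :
  set (edge G) := [set e | source e = w /\ ~ H (range e)].

Definition breaking (H : set (set (vertex G))) : set (vertex G) :=
  [set w | [/\ infinite_set (out_edges w), finite_set (surviving_edges H w)
             & surviving_edges H w !=set0]].

Definition admissible (H : set (set (vertex G))) (B : set (vertex G)) : Prop :=
  [/\ H `<=` gset, H set0, hereditary H, saturated H & B `<=` breaking H].

End SetAlgebra.

(* The values [ck_p A] for [A] outside [gset G] are irrelevant. *)
Record CKfamily (R : realType) (G : ultragraph) (A : cstarAlgType R) := {
  ck_s : edge G -> A;
  ck_p : set (vertex G) -> A;
  ck_partial_isometry : forall e, partial_isometry (ck_s e);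
  ck_orthogonal : forall e f, e <> f ->
    range_projection (ck_s e) ** range_projection (ck_s f) = 0;
  ck_projection : forall V, gset V -> projection (ck_p V);
  ck_set0 : ck_p set0 = 0;
  ck_setI : forall V W, gset V -> gset W -> ck_p V ** ck_p W = ck_p (V `&` W);
  ck_setU : forall V W, gset V -> gset W ->
    ck_p (V `|` W) = ck_p V + ck_p W - ck_p (V `&` W);
  ck_range : forall e, (ck_s e)^# ** ck_s e = ck_p (range e);
  ck_source : forall e,
    subprojection (range_projection (ck_s e)) (ck_p [set source e]);
  ck_sum : forall v, regular v ->
    ck_p [set v] = \sum_(e \in out_edges v) range_projection (ck_s e)
}.

Definition universal_CKfamily (R : realType) (G : ultragraph)
    (A : cstarAlgType R) (F : CKfamily G A) : Prop :=
  generates ([set ck_s F e | e in setT] `|` [set ck_p F V | V in @gset G]) /\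
  forall (D : cstarAlgType R) (F' : CKfamily G D),
    exists phi : A -> D, [/\ star_hom phi,
      (forall e, phi (ck_s F e) = ck_s F' e)
    & (forall V, gset V -> phi (ck_p F V) = ck_p F' V)].

Section AdmissibleIdeal.
Context {R : realType} {G : ultragraph} {A : cstarAlgType R}.
Variables (F : CKfamily G A) (H : set (set (vertex G))) (B : set (vertex G)).

Definition gap_projection (w : vertex G) : A :=
  ck_p F [set w] -
  \sum_(e \in surviving_edges H w) range_projection (ck_s F e).

Definition admissible_generators : set A :=
  [set ck_p F V | V in H `&` @gset G] `|` [set gap_projection w | w in B].

Lemma gset1 (v : vertex G) : gset [set v].
Proof. by apply: sub_gen_smallest; left; exists v. Qed.

Lemma admissible_generators_star x :
  admissible_generators x -> admissible_generators x^#.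
Proof.
move=> [[V [HV GV] <-]|[w Bw <-]].
  by left; exists V => //; rewrite (ck_projection F GV).1.
right; exists w => //; rewrite /gap_projection starD starN.
rewrite (ck_projection F (gset1 w)).1; congr (_ - _).
apply: (big_ind (fun y : A => y = y^#)) => [|y z {1}-> {1}->|e _].
- by rewrite star0.
- by rewrite starD.
- by rewrite /range_projection starM starK.
Qed.

Definition admissible_ideal : sideal A :=
  SIdeal (closed_ideal_generated admissible_generators)
    (ideal_generated_star admissible_generators_star).

End AdmissibleIdeal.

Section QuotientUltragraph.
Variables (G : ultragraph) (H : set (set (vertex G))) (B : set (vertex G)).

Definition split_vertices : set (vertex G) := breaking H `\` B.

(* [inl v] is the vertex v and [inr w] is the new vertex w'. *)
Definition ext_vertex : countType := (vertex G + set_type split_vertices)%type.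

Definition ext_source (e : edge G) : ext_vertex :=
  match pselect (split_vertices (source e) /\ H (range e)) with
  | left h => inr (SigSub (mem_set h.1))
  | right _ => inl (source e)
  end.

Definition ext_set (V : set (vertex G)) : set ext_vertex :=
  [set inl v | v in V] `|`
  [set inr w | w in [set w : set_type split_vertices | V (val w)]].

Definition ext_range (e : edge G) : set ext_vertex := ext_set (range e).

Lemma ext_range_neq0 e : ext_range e !=set0.
Proof. by have [v ev] := range_neq0 e; exists (inl v); left; exists v. Qed.

Definition extended : ultragraph := Ultragraph ext_source ext_range_neq0.

(* For saturated hereditary H, a set V in H contains no vertex of
   [split_vertices], so that [ext_set V] is just the copy of V. *)
Definition ext_H : set (set ext_vertex) := [set ext_set V | V in H].

(* The quotient ultragraph G/(H,B): its vertices are [qvertices], its sets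
   [qsets], its edges [qedges], with range [qrange] and source [qsource]; the
   class of a set is encoded as a set of sets. *)
Definition qequiv (X Y : set ext_vertex) : Prop :=
  exists2 V, ext_H V & X `|` V = Y `|` V.

Definition qclass (X : set ext_vertex) : set (set ext_vertex) :=
  [set Y | @gset extended Y /\ qequiv X Y].

Definition qvertices : set (set (set ext_vertex)) :=
  [set qclass [set inl v] | v in [set v | ~ H [set v]]] `|`
  [set qclass [set inr w] | w in [set: set_type split_vertices]].

Definition qsets : set (set (set ext_vertex)) :=
  [set qclass X | X in @gset extended].

Definition qedges : set (edge G) := [set e | ~ ext_H (ext_range e)].

Definition qrange (e : edge G) : set (set ext_vertex) := qclass (ext_range e).

Definition qsource (e : edge G) : set (set ext_vertex) :=
  qclass [set ext_source e].

Definition qout_edges (c : set (set ext_vertex)) : set (edge G) :=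
  [set e | qedges e /\ qsource e = c].

(* The values of [qr_t] outside [qedges] and of [qr_q] outside [qsets] are
   irrelevant. *)
Record qrepresentation (R : realType) (D : cstarAlgType R) := {
  qr_t : edge G -> D;
  qr_q : set (set ext_vertex) -> D;
  qr_partial_isometry : forall e, qedges e -> partial_isometry (qr_t e);
  qr_projection : forall c, qsets c -> projection (qr_q c);
  qr_set0 : qr_q (qclass set0) = 0;
  qr_setI : forall X Y, @gset extended X -> @gset extended Y ->
    qr_q (qclass (X `&` Y)) = qr_q (qclass X) ** qr_q (qclass Y);
  qr_setU : forall X Y, @gset extended X -> @gset extended Y ->
    qr_q (qclass (X `|` Y)) =
    qr_q (qclass X) + qr_q (qclass Y) - qr_q (qclass (X `&` Y));
  qr_range : forall e, qedges e -> (qr_t e)^# ** qr_t e = qr_q (qrange e);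
  qr_orthogonal : forall e f, qedges e -> qedges f -> e <> f ->
    (qr_t e)^# ** qr_t f = 0;
  qr_source : forall e, qedges e ->
    subprojection (range_projection (qr_t e)) (qr_q (qsource e));
  qr_sum : forall c, qvertices c ->
    finite_set (qout_edges c) -> qout_edges c !=set0 ->
    qr_q c = \sum_(e \in qout_edges c) range_projection (qr_t e)
}.

Definition universal_qrepresentation (R : realType) (D : cstarAlgType R)
    (T : qrepresentation D) : Prop :=
  generates ([set qr_t T e | e in qedges] `|` [set qr_q T c | c in qsets]) /\
  forall (D' : cstarAlgType R) (T' : qrepresentation D'),
    exists phi : D -> D', [/\ star_hom phi,
      (forall e, qedges e -> phi (qr_t T e) = qr_t T' e)
    & (forall c, qsets c -> phi (qr_q T c) = qr_q T' c)].

End QuotientUltragraph.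

(* Main.v *)
From HB Require Import structures.
From mathcomp Require Import all_boot all_order all_algebra.
From mathcomp Require Import complex finmap ring lra.
From mathcomp Require Import boolp classical_sets.
From mathcomp Require Import cardinality fsbigop reals topology normedtype sequences.
Require Import Defs.

Set Implicit Arguments.
Unset Strict Implicit.
Unset Printing Implicit Defensive.

Import Order.TTheory GRing.Theory Num.Theory.
Import numFieldNormedType.Exports.

Local Open Scope classical_set_scope.
Local Open Scope ring_scope.
Local Open Scope cstar_scope.

(** Write J for the ideal I_(H,B), and g_w for the gap projection p_w^H. The two
universal properties are played against each other.

In A = C*(G) the split vertex w already has two halves: g_w can serve as the
projection of the new vertex w', and p_w - g_w as that of w in the extended
ultragraph. A set X of the extended algebra of sets disagrees with a set of the
form [ext_set V] at finitely many split vertices only ([gset_unprimed]), so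
  P_X = p_(X /\ G^0) + sum_w ([w' in X] - [w in X]) g_w
is a finite sum; X |-> P_X respects intersections and unions
([ext_projectionI], [ext_projectionU]). Modulo J it depends only on the class of
X, and with the images of the s_e it is a representation of G/(H,B) in A/J
([quotient_representation]). This gives psi : D -> A/J, with D = C*(G/(H,B)).

Conversely S_e = t_e or 0, according to whether r(e) lies outside H or not,
and V |-> q_[ext_set V] form a Cuntz-Krieger G-family in D ([induced_family]).
This gives pi : A -> D, which kills the generators of J ([pi_kernel]) and so
factors through A/J. The key identity pi(P_X) = q_[X] ([pi_ext_projection])
shows that psi and the factored map are inverse to each other on generators.

The argument uses two facts on C*-algebras: *-homomorphisms are contractive
([star_hom_contractive]), and A/J with the quotient norm is a C*-algebra. Both
rest on one observation. If j is self-adjoint and |j| < 1, a fixed point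
argument gives a self-adjoint z, in any closed ideal that contains j, commuting
with j and such that (1 - z)^2 + j^2 = 1 ([circle_pair_exists]). Then the
elements (1 - z) + ij and (1 - z) - ij of the unitization are mutually inverse
unitaries, like e^(it) and e^(-it) with cos t = 1 - z and sin t = j.
 - Half their difference is ij up to sign, so |j| <= 1 ([circle_pair_le1]). As
   the equation survives any *-homomorphism, *-homomorphisms contract.
 - The difference of their squares is 4ij(1 - z) up to sign, so |j(1 - z)| <= 1/2
   ([circle_pair_half]): this is sin t cos t = (sin 2t)/2. Iteration gives an
   element e of the ideal with j(1 - e) small and |1 - e| <= 1
   ([approximate_unit]), and the C*-identity of the quotient follows
   ([quotient_cstar_le]).
*)

(** * Real-valued norms and geometric convergence *)

Lemma Re_norm (R : realType) (k : R[i]) : (complex.Re `|k|)%:C%C = `|k|.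
Proof. by rewrite RRe_real//; apply: normr_real. Qed.

Lemma Re_norm_gt0 (R : realType) (k : R[i]) : k != 0 -> 0 < complex.Re `|k|.
Proof. by move=> k0; rewrite -(@ltcR R) Re_norm normr_gt0. Qed.

Section RealNorm.
Context {R : realType} {V : normedModType R[i]}.
Implicit Types x y : V.

(** The norm takes its values in [R[i]], where the order is partial; estimates
are carried out on its real part, in the ordered field [R]. *)
Definition rnorm x : R := complex.Re `|x|.

Lemma rnormE x : `|x| = (rnorm x)%:C%C.
Proof. by rewrite /rnorm RRe_real//; apply: normr_real. Qed.

Lemma rnorm_ge0 x : 0 <= rnorm x.
Proof. by rewrite -(@lecR R) -rnormE normr_ge0. Qed.

Lemma ler_rnormD x y : rnorm (x + y) <= rnorm x + rnorm y.
Proof. by rewrite -(@lecR R) rmorphD/= -!rnormE ler_normD. Qed.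

Lemma rnormN x : rnorm (- x) = rnorm x.
Proof. by rewrite /rnorm normrN. Qed.

Lemma rnormZ (k : R[i]) x : rnorm (k *: x) = complex.Re `|k| * rnorm x.
Proof.
by apply: complexI; rewrite rmorphM/= -!rnormE normrZ.
Qed.

Lemma rnormZR (a : R) x : rnorm (a%:C%C *: x) = `|a| * rnorm x.
Proof. by rewrite rnormZ normc_def/= expr0n/= addr0 sqrtr_sqr. Qed.

Lemma rnormZi x : rnorm ('i%C *: x) = rnorm x.
Proof. by rewrite rnormZ normc_def/= expr0n/= expr1n add0r sqrtr1 mul1r. Qed.

Lemma rnorm0 : rnorm (0 : V) = 0.
Proof. by rewrite /rnorm normr0. Qed.

Lemma rnorm_eq0 x : rnorm x = 0 -> x = 0.
Proof. by move=> x0; apply/eqP; rewrite -normr_eq0 rnormE x0. Qed.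

Lemma ball_rnormP x (e : R) y : ball x e%:C%C y <-> rnorm (x - y) < e.
Proof. by rewrite -ball_normE /ball_/= rnormE ltcR. Qed.

Lemma gt0_complexE (e : R[i]) : 0 < e -> e = (complex.Re e)%:C%C /\ 0 < complex.Re e.
Proof.
move=> e0; have E : e = (complex.Re e)%:C%C by rewrite RRe_real// gtr0_real.
by split => //; rewrite -(@ltcR R) -E.
Qed.

Lemma closed_rnorm (M : set V) x : closed M ->
  (forall e : R, 0 < e -> exists2 y, M y & rnorm (x - y) < e) -> M x.
Proof.
move=> cM Mx; apply: cM => U; rewrite -nbhs_ballE => -[e /= e0 xU].
have [eE re0] := gt0_complexE e0; have [y My xy] := Mx _ re0.
by exists y; split => //; apply: xU; rewrite eE; apply/ball_rnormP.
Qed.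

End RealNorm.

Section RealNormComplete.
Context {R : realType} {V : completeNormedModType R[i]}.

(** Steps bounded by C r^n leave a tail bounded by C r^n / (1 - r), so the
sequence is Cauchy. *)
Lemma geometric_cvg (u : nat -> V) (C r : R) : 0 <= r < 1 ->
  (forall n, rnorm (u n.+1 - u n) <= C * r ^+ n) ->
  exists l : V, forall e : R, 0 < e ->
    exists N, forall n, (N <= n)%N -> rnorm (u n - l) < e.
Proof.
move=> /andP[r0 r1] Hu.
have C0 : 0 <= C by have := Hu 0%N; rewrite expr0 mulr1; apply: le_trans (rnorm_ge0 _).
have tail n k : rnorm (u (n + k)%N - u n) <= C * r ^+ n / (1 - r).
  (* telescoping; multiplied by 1 - r, the bound is stable under induction *)
  have H : (1 - r) * rnorm (u (n + k)%N - u n) <= C * r ^+ n - C * r ^+ (n + k).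
    elim: k => [|k IH]; first by rewrite addn0 !subrr rnorm0 mulr0.
    have := ler_rnormD (u (n + k).+1 - u (n + k)%N) (u (n + k)%N - u n).
    rewrite addrA addrNK addnS exprS => Ht.
    have := Hu (n + k)%N => Hk.
    have : rnorm (u (n + k).+1 - u n) <= C * r ^+ (n + k) + rnorm (u (n + k)%N - u n).
      by apply: le_trans Ht _; rewrite lerD2r.
    move=> /(ler_wpM2l (_ : 0 <= 1 - r)); rewrite subr_ge0 => /(_ (ltW r1)).
    by move=> /le_trans; apply; lra.
  rewrite ler_pdivlMr ?subr_gt0// mulrC; apply: le_trans H _.
  by rewrite lerBlDr lerDl mulr_ge0// exprn_ge0.
have small (e : R) : 0 < e -> exists N, forall n, (N <= n)%N -> C * r ^+ n / (1 - r) < e.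
  move=> e0.
  have : (fun n => C * r ^+ n / (1 - r)) @ \oo --> (0 : R).
    rewrite (_ : 0 = C * 0 / (1 - r)); last by rewrite mulr0 mul0r.
    by apply: cvgMl; apply: cvgMr; apply: cvg_expr; rewrite ger0_norm.
  move=> /cvgrPdist_lt /(_ _ e0) [N _ HN]; exists N => n /HN/=.
  by rewrite sub0r normrN; apply: le_lt_trans; rewrite ler_norm.
have : cvg (u @ \oo).
  apply: cauchy_cvg; apply: cauchy_exP => e /gt0_complexE[-> re0].
  have [N HN] := small _ re0; exists (u N); exists N => // n /= Nn.
  apply/ball_rnormP; rewrite -opprB rnormN -(subnKC Nn).
  exact: le_lt_trans (tail _ _) (HN _ _).
move=> /cvg_ex[l ul]; exists l => e e0.
have e0' : 0 < e%:C%C :> R[i] by rewrite ltcR.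
have /cvgrPdist_lt/(_ _ e0')[N _ HN] := ul.
by exists N => n /HN /=; rewrite rnormE ltcR -opprB rnormN.
Qed.

End RealNormComplete.

(** * The unitary attached to a self-adjoint contraction *)

Section CStarNorm.
Context {R : realType} {A : cstarAlgType R}.
Implicit Types x y z j t : A.

Lemma rnormM x y : rnorm (x ** y) <= rnorm x * rnorm y.
Proof. by rewrite -(@lecR R) rmorphM/= -!rnormE ler_norm_amul. Qed.

Lemma rnorm_star x : rnorm x^# = rnorm x.
Proof. by rewrite /rnorm norm_star. Qed.

Lemma rnorm_cstar x : rnorm (x^# ** x) = rnorm x ^+ 2.
Proof. by apply: complexI; rewrite rmorphXn/= -!rnormE cstar_identity. Qed.

Lemma amulNl x y : (- x) ** y = - (x ** y).
Proof. by rewrite -(scaleN1r x) amulZl scaleN1r. Qed.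

Lemma amulNr x y : x ** (- y) = - (x ** y).
Proof. by rewrite -(scaleN1r y) amulZr scaleN1r. Qed.

Lemma subr_interchange (V : zmodType) (x y z t : V) :
  (x - y) - (z - t) = (x - z) - (y - t).
Proof. by rewrite !opprD !opprK addrACA. Qed.

Lemma conj_real (a : R) : (a%:C%C : R[i])^* = a%:C%C.
Proof. exact: conjc_real. Qed.

Let conj_i : ('i%C : R[i])^* = - 'i%C.
Proof. by apply/eqP; rewrite eq_complex/= oppr0 !eqxx. Qed.

Lemma rnorm_small_eq0 (K : R) x : 0 <= K ->
  (forall e : R, 0 < e -> rnorm x <= K * e) -> x = 0.
Proof.
move=> K0 Hx; apply: rnorm_eq0; apply/eqP; rewrite eq_le rnorm_ge0 andbT.
apply/ler_addgt0Pl => e e0; rewrite addr0.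
have K1 : 0 < K + 1 by lra.
have /Hx/le_trans -> // : 0 < e / (K + 1) by rewrite divr_gt0.
by rewrite mulrCA ger_pMr// ler_pdivrMr// mul1r lerDl.
Qed.

(** The last equation says (1 - z)^2 + j^2 = 1, written without a unit: the
pair (1 - z, j) behaves like a cosine and a sine. *)
Definition circle_pair z j : Prop :=
  [/\ z^# = z, j^# = j, z ** j = j ** z & z + z = j ** j + z ** z].

(** z is 1 - sqrt(1 - j^2), obtained as the fixed point of
x |-> (j^2 + x^2) / 2. With rho = |j^2| < 1 this map preserves the ball of radius
rho, because (rho + rho^2) / 2 <= rho, and contracts it by the factor rho. Its
iterates from 0 are polynomials in j, so the properties asked of z hold along the
sequence and pass to the limit. *)
Lemma circle_pair_exists (J : set A) j : closed_ideal J -> J j ->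
  j^# = j -> rnorm j < 1 -> exists2 z, J z & circle_pair z j.
Proof.
move=> [Jcl J0 JD JM] Jj jj j1.
have JD' x y : J x -> J y -> J (x + y) by rewrite -{2}(scale1r x); exact: JD.
have JZ k x : J x -> J (k *: x) by rewrite -(addr0 (k *: x)) => Jx; exact: JD.
set c := j ** j; set rho := rnorm c.
have rho1 : rho < 1.
  rewrite /rho/c -{1}jj rnorm_cstar expr2.
  by apply: mulr_ilt1 => //; exact: rnorm_ge0.
have rho0 : 0 <= rho := rnorm_ge0 _.
pose half : R[i] := (2^-1)%:C%C.
have rhalf x : rnorm (half *: x) = 2^-1 * rnorm x.
  by rewrite rnormZR ger0_norm// invr_ge0.
have half2 x : half *: x + half *: x = x.
  by rewrite -scalerDl -rmorphD/= (_ : 2^-1 + 2^-1 = 1) ?scale1r//; lra.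
pose u := fix u n := if n is n'.+1 then half *: (c + u n' ** u n') else 0.
have uJ n : J (u n).
  elim: n => //= n IH; apply: JZ; apply: JD'; first exact: (JM _ _ Jj).1.
  exact: (JM _ _ IH).1.
have us n : (u n)^# = u n.
  elim: n => [|n IH] /=; first exact: star0.
  by rewrite starZ starD !starM IH jj conj_real.
have uj n : u n ** j = j ** u n.
  elim: n => [|n IH] /=; first by rewrite amul0x amulx0.
  by rewrite amulZl amulZr amulDl amulDr /c !amulA -(amulA (u n)) IH amulA IH.
have un n : rnorm (u n) <= rho.
  elim: n => [|n IH] /=; first by rewrite rnorm0.
  have := ler_rnormD c (u n ** u n); have := rnormM (u n) (u n).
  rewrite rhalf -/rho; have := rnorm_ge0 (u n); nra.
have ud n : rnorm (u n.+1 - u n) <= rnorm (u 1%N) * rho ^+ n.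
  elim: n => [|n IH]; first by rewrite expr0 mulr1 subr0.
  have -> : u n.+2 - u n.+1 =
      half *: (u n.+1 ** (u n.+1 - u n) + (u n.+1 - u n) ** u n).
    rewrite {1}[u n.+2]/= {3}[u n.+1]/= -scalerBr; congr (_ *: _).
    by rewrite opprD addrACA subrr add0r amulBr amulBl addrA subrK.
  rewrite rhalf exprS.
  have := ler_rnormD (u n.+1 ** (u n.+1 - u n)) ((u n.+1 - u n) ** u n).
  have := rnormM (u n.+1) (u n.+1 - u n); have := rnormM (u n.+1 - u n) (u n).
  have := rnorm_ge0 (u n.+1 - u n); have := un n; have := un n.+1.
  move: IH; set d := rnorm (_ - _); set E := rnorm (u 1%N) * _.
  rewrite mulrCA -/E => IH u1 u0 d0 h1 h2 h3.
  have : rho * d <= rho * E by rewrite ler_wpM2l.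
  have : rnorm (u n.+1) * d <= rho * d by rewrite ler_wpM2r.
  have : d * rnorm (u n) <= d * rho by rewrite ler_wpM2l.
  by move: h1 h2 h3; lra.
have [z zu] := geometric_cvg (introT andP (conj rho0 rho1)) ud.
exists z.
  apply: (closed_rnorm Jcl) => e /zu[N /(_ N (leqnn N))] uz.
  by exists (u N) => //; rewrite -opprB rnormN.
split => //.
- apply/eqP; rewrite -subr_eq0; apply/eqP.
  apply: (@rnorm_small_eq0 2) => // e /zu[N /(_ N (leqnn N))] uz.
  have -> : z^# - z = - (u N - z)^# + (u N - z).
    by rewrite starD starN us opprD opprK addrACA addNr add0r.
  by have := ler_rnormD (- (u N - z)^#) (u N - z); rewrite rnormN rnorm_star; lra.
- apply/eqP; rewrite -subr_eq0; apply/eqP.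
  apply: (@rnorm_small_eq0 2) => // e /zu[N /(_ N (leqnn N))] uz.
  have -> : z ** j - j ** z = j ** (u N - z) - (u N - z) ** j.
    by rewrite amulBr amulBl uj opprB [RHS]addrC addrA subrK.
  have := ler_rnormD (j ** (u N - z)) (- ((u N - z) ** j)); rewrite rnormN.
  have := rnormM j (u N - z); have := rnormM (u N - z) j.
  by have := rnorm_ge0 (u N - z); have := rnorm_ge0 j; nra.
- apply/eqP; rewrite -subr_eq0; apply/eqP.
  (* the bound on 2|z - u_(N+1)| + (|z| + |u_N|)|z - u_N| in units of e *)
  apply: (@rnorm_small_eq0 (2 + rnorm z + rho)).
    by have := rnorm_ge0 z; lra.
  move=> e /zu[N uz]; have := uz _ (leqnSn N); have {uz} := uz _ (leqnn N).
  have -> : z + z - (c + z ** z) =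
      - ((u N.+1 - z) + (u N.+1 - z)) + (z ** (u N - z) + (u N - z) ** u N).
    rewrite [z ** _ + _](_ : _ = u N ** u N - z ** z); last first.
      by rewrite amulBr amulBl addrC addrA subrK.
    rewrite [_ + (u N.+1 - z)](_ : _ = c + u N ** u N - (z + z)); last first.
      by rewrite addrACA half2 -opprD.
    by rewrite opprB !opprD !addrA subrK.
  move=> h1 h2.
  have := ler_rnormD (- ((u N.+1 - z) + (u N.+1 - z))) (z ** (u N - z) + (u N - z) ** u N).
  rewrite rnormN.
  have := ler_rnormD (z ** (u N - z)) ((u N - z) ** u N).
  have := ler_rnormD (u N.+1 - z) (u N.+1 - z).
  have := rnormM z (u N - z); have := rnormM (u N - z) (u N).
  have := rnorm_ge0 (u N - z); have := un N; have := rnorm_ge0 (u N); have := rnorm_ge0 z.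
  set d := rnorm (u N - z) in h1 *.
  move=> z0 u0 uN d0 k1 k2 k3 k4 k5.
  have : rnorm z * d <= rnorm z * e by rewrite ler_wpM2l// ltW.
  have : d * rnorm (u N) <= e * rho by rewrite ler_pM// ltW.
  by move: h1 h2 k1 k2 k3 k4 k5; lra.
Qed.

(** The hypothesis says that 1 - t is an isometry: (1 - t)^*(1 - t) = 1. The
C*-identity then turns it into an isometry of the algebra. *)
Lemma unitary_isometry t x : t^# ** t = t + t^# -> rnorm (x - t ** x) = rnorm x.
Proof.
move=> tt; apply/eqP; rewrite -(@eqrXn2 _ 2)// ?rnorm_ge0// -!rnorm_cstar.
apply/eqP; congr rnorm; rewrite starD starN starM amulBl !amulBr !amulA.
by rewrite -[_ ** t^# ** t]amulA tt amulDr amulDl opprB addrK subrK.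
Qed.

Section CirclePair.
Variables z j : A.
Hypothesis zj : circle_pair z j.

(* The unitaries are 1 - t and 1 - ts, acting by L and L' below. *)
Let t := z + 'i%C *: j.
Let ts := z - 'i%C *: j.

Let star_t : t^# = ts.
Proof. by have [zz jj _ _] := zj; rewrite starD starZ zz jj conj_i scaleNr. Qed.

Let star_ts : ts^# = t.
Proof. by rewrite -star_t starK. Qed.

Let ts_t : ts ** t = z + z.
Proof.
have [_ _ C S] := zj.
rewrite amulDl amulNl !amulDr !(amulZr, amulZl) C scalerA -expr2 sqr_i scaleN1r.
by rewrite opprD opprK addrA addrK S addrC.
Qed.
Let t_ts : t ** ts = z + z.
Proof.
have [_ _ C S] := zj.
rewrite amulDl !amulDr !amulNr !(amulZr, amulZl) C scalerA -expr2 sqr_i scaleN1r opprK.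
by rewrite addrA subrK S addrC.
Qed.

Let t_add : t + ts = z + z.
Proof. by rewrite addrACA subrr addr0. Qed.

Let L x := x - t ** x.
Let L' x := x - ts ** x.

Let rL x : rnorm (L x) = rnorm x.
Proof. by apply: unitary_isometry; rewrite star_t ts_t t_add. Qed.
Let rL' x : rnorm (L' x) = rnorm x.
Proof. by apply: unitary_isometry; rewrite star_ts t_ts [RHS]addrC t_add. Qed.

Let LL' x : L (L' x) = x.
Proof.
rewrite /L /L' amulBr amulA t_ts -t_add (amulDl t ts).
by rewrite opprB [t ** x + _]addrC addrK subrK.
Qed.
Let L'L x : L' (L x) = x.
Proof.
rewrite /L /L' amulBr amulA ts_t -t_add (amulDl t ts).
by rewrite opprB addrK subrK.
Qed.

Let addL x : L' x + L x = (x - z ** x) + (x - z ** x).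
Proof.
by rewrite /L /L' addrACA -opprD -amulDl [ts + t]addrC t_add (amulDl z z) opprD addrACA.
Qed.

Let subL x : L' x - L x = ('i%C *: (j ** x)) + ('i%C *: (j ** x)).
Proof.
have tts : t - ts = 'i%C *: j + 'i%C *: j.
  by rewrite /t /ts opprB [z + _]addrC addrACA subrr addr0.
rewrite /L /L' opprB addrC addrA subrK -amulBl tts.
by rewrite (amulDl ('i%C *: j)) amulZl.
Qed.

Let double x y : x + x = y -> rnorm x = rnorm y / 2.
Proof.
move=> <-; have -> : x + x = 2%:R%:C%C *: x.
  by rewrite -mulr2n -scaler_nat; congr (_ *: _); rewrite rmorph_nat.
by rewrite rnormZR ger0_norm//; lra.
Qed.

(** 1 - z is the half-sum of two unitaries. *)
Lemma circle_pair_mul1B x : rnorm (x - z ** x) <= rnorm x.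
Proof.
rewrite (double (esym (addL x))).
have := ler_rnormD (L' x) (L x); rewrite rL rL'; lra.
Qed.

(** [j] is, up to a factor i, the half-difference of two unitaries. *)
Let circle_pair_mulj x : rnorm (j ** x) <= rnorm x.
Proof.
rewrite -rnormZi (double (esym (subL x))).
by have := ler_rnormD (L' x) (- L x); rewrite rnormN rL rL'; lra.
Qed.

(** A bound on the left multiplication by a self-adjoint y, applied to y itself,
bounds |y|^2 by the C*-identity. *)
Let selfadjoint_le y (k : R) : y^# = y -> 0 <= k ->
  (forall x, rnorm (y ** x) <= k * rnorm x) -> rnorm y <= k.
Proof.
move=> yy k0 /(_ y); rewrite -{1}yy rnorm_cstar expr2.
have [->|y0] := eqVneq (rnorm y) 0; first by [].
by rewrite ler_pM2r// lt_neqAle eq_sym y0 rnorm_ge0.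
Qed.

Lemma circle_pair_le1 : rnorm j <= 1.
Proof.
by have [_ jj _ _] := zj; apply: selfadjoint_le => // x; rewrite mul1r circle_pair_mulj.
Qed.

Lemma circle_pair_star : (j - j ** z)^# = j - j ** z.
Proof. by have [zz jj C _] := zj; rewrite starD starN starM zz jj C. Qed.

(** As L L' = 1 = L' L, one has L'^2 - L^2 = (L' + L)(L' - L), which is left
multiplication by 4i(1 - z)j. *)
Lemma circle_pair_half : rnorm (j - j ** z) <= 2^-1.
Proof.
have [_ _ C _] := zj.
apply: selfadjoint_le => [||x]; [exact: circle_pair_star | by rewrite invr_ge0 |].
have L'D x1 x2 : L' (x1 + x2) = L' x1 + L' x2.
  by rewrite /L' amulDr opprD addrACA.
have E : L' (L' x) - L (L x) =
   (L' ('i%C *: (j ** x)) + L ('i%C *: (j ** x))) + (L' ('i%C *: (j ** x)) + L ('i%C *: (j ** x))).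
  rewrite addrACA -L'D -subL.
  have -> : L ('i%C *: (j ** x)) + L ('i%C *: (j ** x)) = L (L' x - L x).
    by rewrite subL /L amulDr opprD addrACA.
  have -> : L (L' x - L x) = L (L' x) - L (L x).
    by rewrite {1}/L amulBr subr_interchange.
  have -> : L' (L' x - L x) = L' (L' x) - L' (L x).
    by rewrite {1}/L' amulBr subr_interchange.
  by rewrite LL' L'L addrA subrK.
have W : (j - j ** z) ** x = (j ** x) - z ** (j ** x).
  by rewrite amulBl -C amulA.
rewrite W -rnormZi scalerBr -(amulZr _ z).
rewrite (double (esym (addL ('i%C *: (j ** x))))) (double (esym E)).
by have := ler_rnormD (L' (L' x)) (- L (L x)); rewrite rnormN !rL !rL'; lra.
Qed.

End CirclePair.

End CStarNorm.

Section Contractive.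
Context {R : realType} {A D : cstarAlgType R}.

Lemma star_hom0 (A1 A2 : starAlgType R) (f : A1 -> A2) : star_hom f -> f 0 = 0.
Proof. by move=> [lf _ _]; have := lf (-1) 0 0; rewrite scaler0 add0r scaleN1r addNr. Qed.

Lemma star_homD (A1 A2 : starAlgType R) (f : A1 -> A2) : star_hom f ->
  {morph f : x y / x + y}.
Proof. by move=> [lf _ _] x y; have := lf 1 x y; rewrite !scale1r. Qed.

Lemma star_homZ (A1 A2 : starAlgType R) (f : A1 -> A2) : star_hom f ->
  forall k, {morph f : x / k *: x}.
Proof.
move=> hf k x; have [lf _ _] := hf; have := lf k x 0.
by rewrite (star_hom0 hf) !addr0.
Qed.

Lemma star_homN (A1 A2 : starAlgType R) (f : A1 -> A2) : star_hom f ->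
  {morph f : x / - x}.
Proof. by move=> hf x; rewrite -scaleN1r (star_homZ hf) scaleN1r. Qed.

Lemma star_homB (A1 A2 : starAlgType R) (f : A1 -> A2) : star_hom f ->
  {morph f : x y / x - y}.
Proof. by move=> hf x y; rewrite (star_homD hf) (star_homN hf). Qed.

(** Continuity is not assumed. For a self-adjoint a of norm < 1 the image of a
circle pair is a circle pair, hence |f a| <= 1; scaling and the C*-identity do
the rest. *)
Theorem star_hom_contractive (f : A -> D) : star_hom f ->
  forall x, rnorm (f x) <= rnorm x.
Proof.
move=> hf; have [_ fM fS] := hf.
have Tideal : closed_ideal (setT : set A) by split => //; exact: closedT.
have key a : a^# = a -> rnorm a < 1 -> rnorm (f a) <= 1.
  move=> aa a1.
  have [z _ [zz _ C S]] := circle_pair_exists Tideal I aa a1.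
  apply: (@circle_pair_le1 _ _ (f z)).
  by split; rewrite -?fS -?fM ?zz ?aa ?C// -!(star_homD hf) S.
have sa a : a^# = a -> rnorm (f a) <= rnorm a.
  move=> aa; apply/ler_addgt0Pl => e e0.
  set k := e + rnorm a; have k0 : 0 < k by rewrite ltr_pwDl// rnorm_ge0.
  have := key (k^-1%:C%C *: a); rewrite starZ aa conj_real => /(_ erefl).
  rewrite (star_homZ hf) !rnormZR gtr0_norm ?invr_gt0//.
  rewrite ![k^-1 * _]mulrC ltr_pdivrMr// ler_pdivrMr// !mul1r; apply.
  by rewrite ltrDr.
move=> x; rewrite -(@ler_pXn2r _ 2) ?nnegrE ?rnorm_ge0// -!rnorm_cstar -fS -fM.
by apply: sa; rewrite starM starK.
Qed.

End Contractive.

(** * The quotient of a C*-algebra by a closed ideal *)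

Section ApproximateUnit.
Context {R : realType} {A : cstarAlgType R} (J : set A).
Hypothesis idealJ : closed_ideal J.

(** Multiplication by 1 - e, on either side, is a contraction. *)
Definition contractive_complement (e : A) : Prop :=
  forall x, rnorm (x - e ** x) <= rnorm x /\ rnorm (x - x ** e) <= rnorm x.

(** [circle_pair_half] after scaling j to norm less than 1. The factor 2/3 in
place of 1/2 makes the inequality strict, so that the step can be repeated. *)
Lemma damping_step (j : A) (c : R) : J j -> j^# = j -> rnorm j < c ->
  exists z, [/\ J z, contractive_complement z, (j - j ** z)^# = j - j ** z
              & rnorm (j - j ** z) < c * (2 / 3)].
Proof.
move=> Jj jj jc; have [_ J0 JD JM] := idealJ.
have c0 : 0 < c := le_lt_trans (rnorm_ge0 _) jc.
have Jk : J (c^-1%:C%C *: j) by rewrite -(addr0 (_ *: _)); exact: JD.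
have kk : (c^-1%:C%C *: j)^# = c^-1%:C%C *: j.
  by rewrite starZ jj; congr (_ *: _); exact: conjc_real.
have k1 : rnorm (c^-1%:C%C *: j) < 1.
  by rewrite rnormZR gtr0_norm ?invr_gt0// mulrC ltr_pdivrMr// mul1r.
have [z Jz P] := circle_pair_exists idealJ Jk kk k1.
have jE : j = c%:C%C *: (c^-1%:C%C *: j).
  by rewrite scalerA -rmorphM/= divff ?gt_eqF// scale1r.
have zz : z^# = z by have [] := P.
exists z; split => //.
- move=> x; split; first exact: circle_pair_mul1B P x.
  by rewrite -rnorm_star starD starN starM zz -[leRHS]rnorm_star (circle_pair_mul1B P).
- have [_ _ C _] := P; rewrite starD starN starM zz jj; congr (_ - _).
  by rewrite jE amulZr amulZl C.
- rewrite {1 2}jE amulZl -scalerBr rnormZR gtr0_norm// ltr_pM2l//.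
  by apply: le_lt_trans (circle_pair_half P) _; lra.
Qed.

(** Repeating [damping_step] on j(1 - z) multiplies the factors 1 - z: the
complement of u after one more step is (1 - z)(1 - u), that is, u is replaced by
z + u - z u. *)
Lemma approximate_unit (j : A) (e : R) : J j -> j^# = j -> 0 < e ->
  exists u, [/\ J u, contractive_complement u & rnorm (j - j ** u) < e].
Proof.
move=> Jj jj e0; have [_ J0 JD JM] := idealJ.
have step n : forall j c, J j -> j^# = j -> rnorm j < c ->
    exists u, [/\ J u, contractive_complement u & rnorm (j - j ** u) < c * (2 / 3) ^+ n].
  elim: n => [|n IH] {jj Jj}j c Jj jj jc.
    exists 0; split=> // [x|]; last by rewrite amulx0 subr0 expr0 mulr1.
    by rewrite amulx0 amul0x subr0.
  have [z [Jz zc sz zl]] := damping_step Jj jj jc.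
  have Jjz : J (j - j ** z).
    by rewrite addrC -scaleN1r; apply: JD => //; exact: (JM _ _ Jz).1.
  have [u [Ju uc ul]] := IH _ _ Jjz sz zl.
  have E x : x - x ** (z + u - z ** u) = (x - x ** z) - (x - x ** z) ** u.
    by rewrite amulBr amulDr amulBl amulA -(addrA (x ** z)) opprD addrA.
  exists (z + u - z ** u); split.
  - rewrite addrC -scaleN1r; apply: (JD); first exact: (JM _ _ Ju).1.
    by rewrite -(scale1r z); exact: JD.
  - move=> x; split; last by rewrite E; apply: le_trans (uc _).2 (zc _).2.
    rewrite (_ : x - _ = (x - u ** x) - z ** (x - u ** x)).
      by apply: le_trans (zc _).1 (uc _).1.
    by rewrite amulBl amulDl amulBr amulA [z ** x + u ** x]addrC -(addrA (u ** x)) opprD addrA.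
  - by rewrite [rnorm _](congr1 rnorm (E j)) exprS mulrA.
have [n hn] : exists n, (rnorm j + 1) * (2 / 3) ^+ n < e.
  have : (fun n => (rnorm j + 1) * (2 / 3) ^+ n) @ \oo --> (0 : R).
    rewrite (_ : 0 = (rnorm j + 1) * 0); last by rewrite mulr0.
    by apply: cvgMr; apply: cvg_expr; rewrite ger0_norm; lra.
  move=> /cvgrPdist_lt /(_ _ e0) [n _ /(_ n (leqnn n))/=].
  by rewrite sub0r normrN => /(le_lt_trans (ler_norm _)); exists n.
have [|u [Ju uc ul]] := step n j (rnorm j + 1) Jj jj; first by lra.
by exists u; split=> //; apply: lt_trans ul hn.
Qed.

End ApproximateUnit.

Section QuotientCStar.
Context {R : realType} {A : cstarAlgType R} (J : sideal A).
Implicit Types (u v : quotient J) (x y : A).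

Lemma qproj_star_hom : star_hom (qproj J).
Proof.
split; last exact: qproj_star; last exact: qprojM.
by move=> k x y; rewrite qprojD qproj_scale.
Qed.

Let qproj0 : qproj J 0 = 0.
Proof. exact: star_hom0 qproj_star_hom. Qed.

Let qprojB x y : qproj J (x - y) = qproj J x - qproj J y.
Proof. exact: star_homB qproj_star_hom x y. Qed.

Let norm_set u := [set complex.Re `|x| | x in [set x : A | qproj J x = u]].

Let norm_set_has_inf u : has_inf (norm_set u).
Proof.
split; first by have [x xu] := qproj_surj u; exists (rnorm x); exists x.
by exists 0 => _ [x _ <-]; exact: rnorm_ge0.
Qed.

Lemma quotient_norm_le x : quotient_norm (qproj J x) <= rnorm x.
Proof.
by apply: ge_inf; [exact: (norm_set_has_inf _).2 | exists x].
Qed.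

Lemma quotient_norm_lt u (K : R) : quotient_norm u < K ->
  exists2 x, qproj J x = u & rnorm x < K.
Proof.
by move=> /(inf_lt (norm_set_has_inf u).1)[_ [x xu <-] xK]; exists x.
Qed.

Lemma quotient_norm_leP u (K : R) :
  (forall x, qproj J x = u -> K <= rnorm x) -> K <= quotient_norm u.
Proof.
move=> H; rewrite leNgt; apply/negP => /quotient_norm_lt[x /H]; lra.
Qed.

Lemma quotient_norm_ge0 u : 0 <= quotient_norm u.
Proof. by apply: quotient_norm_leP => x _; exact: rnorm_ge0. Qed.

Let qnorm u : R[i] := (quotient_norm u)%:C%C.

Let ler_quotient_normD u v :
  quotient_norm (u + v) <= quotient_norm u + quotient_norm v.
Proof.
apply/ler_addgt0Pl => e e0.
have [|x <- ux] := @quotient_norm_lt u (quotient_norm u + e / 2); first by lra.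
have [|y <- vy] := @quotient_norm_lt v (quotient_norm v + e / 2); first by lra.
rewrite -qprojD; apply: le_trans (quotient_norm_le _) _.
by apply: le_trans (ler_rnormD _ _) _; lra.
Qed.

Let ler_quotient_normZ (k : R[i]) u :
  quotient_norm (k *: u) <= complex.Re `|k| * quotient_norm u.
Proof.
have [->|k0] := eqVneq k 0.
  rewrite scale0r normr0 mul0r.
  by rewrite -qproj0; apply: le_trans (quotient_norm_le 0) _; rewrite rnorm0.
have k1 := Re_norm_gt0 k0.
rewrite mulrC -ler_pdivrMr//; apply: quotient_norm_leP => x <-.
rewrite ler_pdivrMr// -qproj_scale; apply: le_trans (quotient_norm_le _) _.
by rewrite rnormZ mulrC.
Qed.

Let quotient_normZ (k : R[i]) u : qnorm (k *: u) = `|k| * qnorm u.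
Proof.
suff le : complex.Re `|k| * quotient_norm u <= quotient_norm (k *: u).
  apply/eqP; rewrite eq_le -[ `|k|]Re_norm -rmorphM !lecR.
  by rewrite ler_quotient_normZ.
have [->|k0] := eqVneq k 0; first by rewrite normr0 mul0r quotient_norm_ge0.
have k1 := Re_norm_gt0 k0.
rewrite -[u in leLHS]scale1r -(mulVf k0) -scalerA mulrC -ler_pdivlMr//.
apply: le_trans (ler_quotient_normZ _ _) _; rewrite mulrC ler_wpM2l ?quotient_norm_ge0//.
by rewrite normfV -[ `|k| in leLHS]Re_norm -fmorphV.
Qed.

Let quotient_norm_eq0 u : qnorm u = 0 -> u = 0.
Proof.
have [cJ J0 JD _] := sideal_closed_ideal J.
move=> /(@complexI R) u0; have [x xu] := qproj_surj u; rewrite -xu.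
rewrite -qproj0; apply/qproj_eqP; rewrite subr0; apply: (closed_rnorm cJ) => e e0.
have [|y yu ye] := @quotient_norm_lt u e; first by rewrite u0.
exists (x - y); first by apply/qproj_eqP; rewrite xu yu.
by rewrite opprB addrC subrK.
Qed.

Let ler_qnormD u v : qnorm (u + v) <= qnorm u + qnorm v.
Proof. by rewrite -rmorphD/= lecR ler_quotient_normD. Qed.

HB.instance Definition _ :=
  Lmodule_isNormed.Build R[i] (quotient J) ler_qnormD quotient_normZ quotient_norm_eq0.

Lemma rnorm_quotient u : rnorm u = quotient_norm u.
Proof. by []. Qed.

(** A Cauchy filter is followed along points w_n whose consecutive differences
have norm less than 2 (1/2)^n; these differences lift to A with the same bounds, so the lifts
converge in A, and the image of the limit is the limit. *)
Lemma quotient_complete (F : set_system (quotient J)) :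
  ProperFilter F -> cauchy F -> cvg F.
Proof.
move=> FF /cauchyP Fc.
have H n : exists u, F (ball u (2^-1 ^+ n)%:C%C).
  by apply: Fc; rewrite ltcR exprn_gt0// invr_gt0.
have [w wF] := choice H.
have dist n : quotient_norm (w n.+1 - w n) < 2 * 2^-1 ^+ n.
  have [v [/ball_rnormP v1 /ball_rnormP v2]] := filter_ex (filterI (wF n) (wF n.+1)).
  have -> : w n.+1 - w n = (w n.+1 - v) - (w n - v) by rewrite opprB addrA subrK.
  rewrite -rnorm_quotient; apply: le_lt_trans (ler_rnormD _ _) _.
  rewrite rnormN; move: v1 v2; rewrite exprS.
  have : 0 < (2^-1 : R) ^+ n by rewrite exprn_gt0// invr_gt0.
  by lra.
have H2 n : exists x, qproj J x = w n.+1 - w n /\ rnorm x < 2 * 2^-1 ^+ n.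
  by have [x] := quotient_norm_lt (dist n); exists x.
have [d dP] := choice H2.
have [x0 x0w] := qproj_surj (w 0%N).
pose x := fix x n := if n is n'.+1 then x n' + d n' else x0.
have xw n : qproj J (x n) = w n.
  by elim: n => //= n IH; rewrite qprojD IH (dP n).1 addrC subrK.
have [|n|l xl] := @geometric_cvg _ _ x 2 2^-1.
- by apply/andP; split; lra.
- by rewrite /= [x n + _]addrC addrK ltW// (dP n).2.
apply/cvg_ex; exists (qproj J l) => /= U; rewrite -nbhs_ballE => -[e /= /gt0_complexE[eE re] eU].
have [N HN] := xl _ (divr_gt0 re (ltr0Sn _ 1)).
have : (fun n => (2^-1 : R) ^+ n) @ \oo --> (0 : R).
  by apply: cvg_expr; rewrite ger0_norm; lra.
move=> /cvgrPdist_lt /(_ _ (divr_gt0 re (ltr0Sn _ 1)))[M _ HM].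
have {}HM := HM (maxn M N) (leq_maxl _ _); have {}HN := HN (maxn M N) (leq_maxr _ _).
move: (wF (maxn M N)); apply: filterS => v /ball_rnormP wv; apply: eU; rewrite eE; apply/ball_rnormP.
have -> : qproj J l - v = (w (maxn M N) - v) - (w (maxn M N) - qproj J l).
  by rewrite opprB [RHS]addrC addrA subrK.
apply: le_lt_trans (ler_rnormD _ _) _; rewrite rnormN.
have : rnorm (w (maxn M N) - qproj J l) < complex.Re e / 2.
  apply: le_lt_trans HN; rewrite -xw rnorm_quotient.
  by apply: le_trans (quotient_norm_le _); rewrite qprojB.
move: HM wv => /=; rewrite sub0r normrN ger0_norm ?exprn_ge0 ?invr_ge0//; lra.
Qed.

HB.instance Definition _ := Uniform_isComplete.Build (quotient J) quotient_complete.

Let ler_quotient_normM u v : `|u ** v| <= `|u| * `|v|.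
Proof.
rewrite !rnormE -rmorphM/= lecR !rnorm_quotient.
apply/ler_addgt0Pl => e e0.
set a := quotient_norm u; set b := quotient_norm v.
have a0 : 0 <= a := quotient_norm_ge0 u.
have b0 : 0 <= b := quotient_norm_ge0 v.
have c0 : 0 < a + b + 1 by lra.
(* small enough for (a + d)(b + d) <= a b + e *)
pose d := Num.min 1 (e / (a + b + 1)).
have d0 : 0 < d by rewrite lt_min ltr01 divr_gt0.
have d1 : d <= 1 by rewrite ge_min lexx.
have de : d * (a + b + 1) <= e by rewrite -ler_pdivlMr// ge_min lexx orbT.
have [|x ux xa] := @quotient_norm_lt u (a + d); first by rewrite ltrDl.
have [|y vy yb] := @quotient_norm_lt v (b + d); first by rewrite ltrDl.
rewrite -ux -vy; have -> : qproj J x ** qproj J y = qproj J (x ** y).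
  by have [_ ->] := qproj_star_hom.
apply: le_trans (quotient_norm_le _) _; apply: le_trans (rnormM _ _) _.
have : rnorm x * rnorm y <= (a + d) * (b + d).
  by rewrite ler_pM ?rnorm_ge0// ltW.
by move=> /le_trans; apply; nra.
Qed.

(** If |x^* x + j| < K with j in J, which may be taken self-adjoint, choose v in J
with j(1 - v) small. Then y = x(1 - v) has the same class as x, and
y^* y = (1 - v)^*(x^* x + j)(1 - v) - (1 - v)^* j (1 - v) has norm at most K plus
a small error. *)
Let quotient_cstar_le u : quotient_norm u ^+ 2 <= quotient_norm (u^# ** u).
Proof.
apply/ler_addgt0Pl => e e0; have [x <-] := qproj_surj u.
have [_ qM qS] := qproj_star_hom.
have idJ := sideal_closed_ideal J; have [_ J0 JD JM] := idJ.
rewrite -qS -qM; set K := quotient_norm (qproj J (_ ** _)).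
have [|y yx yK] := @quotient_norm_lt (qproj J (x^# ** x)) (K + e / 2).
  by rewrite ltrDl divr_gt0.
pose half : R[i] := (2^-1)%:C%C.
(* w = x^* x + j, the self-adjoint part of a lift y of almost minimal norm *)
pose w := half *: (y + y^#); pose j := w - x^# ** x.
have half2 z : half *: (z + z) = z.
  by rewrite scalerDr -scalerDl -rmorphD/= (_ : 2^-1 + 2^-1 = 1) ?scale1r//; lra.
have wK : rnorm w <= K + e / 2.
  rewrite rnormZR ger0_norm ?invr_ge0//.
  by have := ler_rnormD y y^#; rewrite rnorm_star; lra.
have ww : w^# = w by rewrite starZ conj_real starD starK addrC.
have jj : j^# = j by rewrite starD starN ww starM starK.
have Jj : sideal_set J j.
  apply/qproj_eqP; rewrite (star_homZ qproj_star_hom) (star_homD qproj_star_hom).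
  by rewrite qS yx -qS starM starK half2.
have [v [Jv vc vl]] := approximate_unit idJ Jj jj (divr_gt0 e0 (ltr0Sn _ 1)).
have -> : qproj J x = qproj J (x - x ** v).
  by apply/qproj_eqP; rewrite opprB addrC subrK; exact: (JM _ _ Jv).1.
apply: (@le_trans _ _ (rnorm (x - x ** v) ^+ 2)).
  by rewrite ler_pXn2r ?nnegrE ?rnorm_ge0 ?quotient_norm_ge0 ?quotient_norm_le.
have vs a : rnorm (a - v^# ** a) <= rnorm a.
  by rewrite -rnorm_star starD starN starM starK -[leRHS]rnorm_star; exact: (vc _).2.
rewrite -rnorm_cstar.
have -> : (x - x ** v)^# ** (x - x ** v) =
    ((w - w ** v) - v^# ** (w - w ** v)) - ((j - j ** v) - v^# ** (j - j ** v)).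
  (* N a is (1 - v)^* a (1 - v) *)
  pose N a := (a - a ** v) - v^# ** (a - a ** v).
  have NB a b : N (a - b) = N a - N b.
    rewrite /N amulBl subr_interchange (amulBr _ (a - a ** v)).
    exact: subr_interchange.
  have -> : (x - x ** v)^# ** (x - x ** v) = N (w - j).
    have -> : w - j = x^# ** x by rewrite /j opprB addrC subrK.
    by rewrite /N starD starN starM amulBl !amulBr !amulA.
  exact: NB.
apply: le_trans (ler_rnormD _ _) _; rewrite rnormN.
have := vs (w - w ** v); have := (vc w).2; have := vs (j - j ** v).
by move: vl wK; lra.
Qed.

Let quotient_cstar_identity u : `|u^# ** u| = `|u| ^+ 2.
Proof.
rewrite !rnormE -rmorphXn/= !rnorm_quotient; congr (_%:C%C).
apply/eqP; rewrite eq_le quotient_cstar_le andbT expr2.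
have star_le v : quotient_norm v^# <= quotient_norm v.
  apply: quotient_norm_leP => x <-; have [_ _ <-] := qproj_star_hom.
  by rewrite -rnorm_star; exact: quotient_norm_le.
have := ler_quotient_normM u^# u; rewrite !rnormE -rmorphM/= lecR !rnorm_quotient.
by move=> /le_trans; apply; rewrite ler_wpM2r ?quotient_norm_ge0.
Qed.

HB.instance Definition _ :=
  StarAlgebra_isCStar.Build R (quotient J) ler_quotient_normM quotient_cstar_identity.

End QuotientCStar.

(** * *-homomorphisms and generators *)

Section Equalizer.
Context {R : realType} {A D : cstarAlgType R}.
Implicit Types f g : A -> D.

Lemma closed_zeros f : star_hom f -> closed [set x | f x = 0].
Proof.
move=> hf x clx /=; apply: (@rnorm_small_eq0 _ _ 1) => // e e0.
have [|y [/= fy0 /ball_rnormP xy]] := clx (ball x e%:C%C).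
  by rewrite -nbhs_ballE; exists e%:C%C => //=; rewrite ltcR.
have -> : f x = f (x - y) by rewrite (star_homB hf) fy0 subr0.
by rewrite mul1r; apply: le_trans (star_hom_contractive hf _) (ltW xy).
Qed.

Lemma star_hom_kernel f : star_hom f -> closed_ideal [set x | f x = 0].
Proof.
move=> hf; have [lf fM _] := hf; split.
- exact: closed_zeros.
- exact: star_hom0.
- by move=> k x y /= fx fy; rewrite lf fx fy scaler0 addr0.
- by move=> a x /= fx; rewrite !fM fx amulx0 amul0x.
Qed.

(** As both maps are contractive, the set where they agree is closed. *)
Lemma eq_on_generators (S : set A) f g : star_hom f -> star_hom g ->
  generates S -> (forall x, S x -> f x = g x) -> f =1 g.
Proof.
move=> hf hg gS Sfg x; have [lf fM fS] := hf; have [lg gM gS'] := hg.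
suff C : closed_star_subalgebra [set y | f y = g y].
  by apply: (smallest_sub C Sfg); rewrite gS.
split => //=.
- move=> y cly /=; apply/eqP; rewrite -subr_eq0; apply/eqP.
  apply: (@rnorm_small_eq0 _ _ 2) => // e e0.
  have [|z [/= fz /ball_rnormP yz]] := cly (ball y e%:C%C).
    by rewrite -nbhs_ballE; exists e%:C%C => //=; rewrite ltcR.
  have -> : f y - g y = f (y - z) - g (y - z).
    by rewrite (star_homB hf) (star_homB hg) fz opprB addrA subrK.
  apply: le_trans (ler_rnormD _ _) _; rewrite rnormN.
  have := star_hom_contractive hf (y - z); have := star_hom_contractive hg (y - z).
  lra.
- by rewrite (star_hom0 hf) (star_hom0 hg).
- by move=> k y z fy fz; rewrite lf lg fy fz.
- by move=> y z fy fz; rewrite fM gM fy fz.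
- by move=> y fy; rewrite fS gS' fy.
Qed.

End Equalizer.

Section StarAlgebraSums.
Context {R : realType} {A : starAlgType R}.
Variables (I : eqType) (s : seq I) (a : I -> A).

Lemma amul_sumr x : x ** (\sum_(i <- s) a i) = \sum_(i <- s) x ** a i.
Proof. by apply: (big_morph (amul x)); [exact: amulDr | exact: amulx0]. Qed.

Lemma amul_suml x : (\sum_(i <- s) a i) ** x = \sum_(i <- s) a i ** x.
Proof. by apply: (big_morph (amul^~ x)) => [y z|]; [exact: amulDl | exact: amul0x]. Qed.

Lemma star_sum : (\sum_(i <- s) a i)^# = \sum_(i <- s) (a i)^#.
Proof. by apply: big_morph; [exact: starD | exact: star0]. Qed.

Lemma star_hom_sum (B : starAlgType R) (f : A -> B) : star_hom f ->
  f (\sum_(i <- s) a i) = \sum_(i <- s) f (a i).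
Proof. by move=> hf; apply: big_morph; [exact: star_homD | exact: star_hom0]. Qed.

End StarAlgebraSums.

(** * Gap projections *)

Section Gap.
Context {R : realType} {G : ultragraph} {A : cstarAlgType R}.
Variables (F : CKfamily G A) (H : set (set (vertex G))).

Lemma range_projection_projection (A' : starAlgType R) (s : A') :
  partial_isometry s -> projection (range_projection s).
Proof.
by move=> ss; split; rewrite /range_projection ?starM ?starK// amulA ss.
Qed.

Lemma range_projection_source e (v : vertex G) : source e = v ->
  ck_p F [set v] ** range_projection (ck_s F e) = range_projection (ck_s F e).
Proof.
move=> <-; have [pp _] := ck_projection F (gset1 (source e)).
have [rr _] := range_projection_projection (ck_partial_isometry F e).
by rewrite -{1}rr -pp -starM (ck_source F e).
Qed.

Section OneVertex.
Variable w : vertex G.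
Hypothesis fin : finite_set (surviving_edges H w).

Let E := fset_set (surviving_edges H w).

Let EP e : e \in E <-> surviving_edges H w e.
Proof. by rewrite /E in_fset_set//; split => [/set_mem|/mem_set]. Qed.

Let gapE : gap_projection F H w =
  ck_p F [set w] - \sum_(e <- E) range_projection (ck_s F e).
Proof. by rewrite /gap_projection fsbig_finite. Qed.

Let q := \sum_(e <- E) range_projection (ck_s F e).

Let pq : ck_p F [set w] ** q = q.
Proof.
rewrite amul_sumr; apply: eq_big_seq => e /EP[ew _].
exact: range_projection_source.
Qed.

Let qq : q^# = q.
Proof.
rewrite star_sum; apply: eq_bigr => e _.
by have [] := range_projection_projection (ck_partial_isometry F e).
Qed.

Let qp : q ** ck_p F [set w] = q.
Proof.
by have [pp _] := ck_projection F (gset1 w); rewrite -{1}qq -pp -starM pq.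
Qed.

Lemma range_projection_sum e : surviving_edges H w e ->
  range_projection (ck_s F e) ** q = range_projection (ck_s F e).
Proof.
move=> /EP eE; rewrite amul_sumr (bigD1_seq e)//=; last exact: fset_uniq.
rewrite big1 ?addr0; last by move=> f /eqP fe; apply: ck_orthogonal => /esym.
by have [] := range_projection_projection (ck_partial_isometry F e).
Qed.

Let q2 : q ** q = q.
Proof.
by rewrite {1}/q amul_suml; apply: eq_big_seq => e /EP; exact: range_projection_sum.
Qed.

Lemma gap_projection_projection : projection (gap_projection F H w).
Proof.
rewrite gapE -/q; have [pp p2] := ck_projection F (gset1 w).
split; first by rewrite starD starN pp qq.
by rewrite amulBl !amulBr p2 pq qp q2 subrr subr0.
Qed.

Let pgap : ck_p F [set w] ** gap_projection F H w = gap_projection F H w.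
Proof.
have [_ p2] := ck_projection F (gset1 w).
by rewrite gapE -/q amulBr p2 pq.
Qed.

(** The gap projection lies below p_w, and p_V p_w is p_w or 0. *)
Lemma ck_p_gap (V : set (vertex G)) : gset V ->
  ck_p F V ** gap_projection F H w =
    if `[< V w >] then gap_projection F H w else 0.
Proof.
move=> gV; rewrite -{1}pgap amulA ck_setI//; last exact: gset1.
case: asboolP => Vw.
  by have -> : V `&` [set w] = [set w] by apply/setIidr => x ->.
have -> : V `&` [set w] = set0.
  by rewrite -subset0 => x [Vx xw]; apply: Vw; rewrite -xw.
by rewrite ck_set0 amul0x.
Qed.

Lemma gap_ck_p (V : set (vertex G)) : gset V ->
  gap_projection F H w ** ck_p F V =
    if `[< V w >] then gap_projection F H w else 0.
Proof.
move=> gV; have [gg _] := gap_projection_projection.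
have [pp _] := ck_projection F gV.
by rewrite -{1}gg -{1}pp -starM ck_p_gap//; case: ifP; rewrite ?star0.
Qed.

End OneVertex.

Lemma gap_orthogonal v w : finite_set (surviving_edges H v) ->
  finite_set (surviving_edges H w) -> v <> w ->
  gap_projection F H v ** gap_projection F H w = 0.
Proof.
move=> fv fw vw; have := gap_ck_p fv (gset1 v).
rewrite asboolT// => <-; rewrite -amulA ck_p_gap//; last exact: gset1.
by rewrite asboolF ?amulx0// => /= wv; apply: vw.
Qed.

Lemma ck_edge_orthogonal e f : e <> f -> (ck_s F e)^# ** ck_s F f = 0.
Proof.
move=> ef; have se := ck_partial_isometry F e; have sf := ck_partial_isometry F f.
have -> : (ck_s F e)^# = (ck_s F e)^# ** range_projection (ck_s F e).
  by rewrite -{1}se !starM starK.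
rewrite -[ck_s F f]sf -/(range_projection _) -amulA (amulA (range_projection _)).
by rewrite (ck_orthogonal F ef) amul0x amulx0.
Qed.

End Gap.

(** * Sets of the extended ultragraph *)

Section SetAlgebraInduction.
Variable G : ultragraph.

Lemma gset_ops : closed_set_operations (@gset G).
Proof.
split.
- by move=> F [[]].
- by move=> X Y gX gY F CF; have [[? FI ? ?] _] := CF; apply: FI; [exact: gX | exact: gY].
- by move=> X Y gX gY F CF; have [[? ? FU ?] _] := CF; apply: FU; [exact: gX | exact: gY].
- by move=> X Y gX gY F CF; have [[? ? ? FD] _] := CF; apply: FD; [exact: gX | exact: gY].
Qed.

Lemma gset0 : gset (set0 : set (vertex G)).
Proof. by have [] := gset_ops. Qed.

Lemma gsetI (X Y : set (vertex G)) : gset X -> gset Y -> gset (X `&` Y).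
Proof. by move=> gX gY; have [_ op _ _] := gset_ops; exact: op. Qed.

Lemma gsetU (X Y : set (vertex G)) : gset X -> gset Y -> gset (X `|` Y).
Proof. by move=> gX gY; have [_ _ op _] := gset_ops; exact: op. Qed.

Lemma gsetD (X Y : set (vertex G)) : gset X -> gset Y -> gset (X `\` Y).
Proof. by move=> gX gY; have [_ _ _ op] := gset_ops; exact: op. Qed.

Lemma gset_range (e : edge G) : gset (range e).
Proof. by apply: sub_gen_smallest; right; exists e. Qed.

Lemma gset_ind (P : set (set (vertex G))) : closed_set_operations P ->
  (forall v, P [set v]) -> (forall e, P (range e)) ->
  forall X, gset X -> P X.
Proof.
move=> CP P1 Pr X gX; apply: (smallest_sub CP) gX => Y.
by case=> [[v _ <-]|[e _ <-]].
Qed.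

End SetAlgebraInduction.

Section ExtendedSets.
Variables (G : ultragraph) (H : set (set (vertex G))) (B : set (vertex G)).
Let S := split_vertices H B.
Let ext := extended H B.
Implicit Types (V W : set (vertex G)) (X Y : set (vertex ext)).

Lemma ext_set_inl V v : ext_set V (inl v : vertex ext) <-> V v.
Proof.
split; last by move=> Vv; left; exists v.
by case=> [[u Vu [<-]]|[]].
Qed.

Lemma ext_set_inr V (w : set_type S) : ext_set V (inr w : vertex ext) <-> V (val w).
Proof.
split; last by move=> Vv; right; exists w.
by case=> [[]//|[u Vu [<-]]].
Qed.

Lemma ext_setP X Y :
  (forall v, X (inl v) <-> Y (inl v)) -> (forall w, X (inr w) <-> Y (inr w)) ->
  X = Y.
Proof.
by move=> l r; apply/seteqP; split=> -[v|w]; [case: (l v)|case: (r w)|case: (l v)|case: (r w)].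
Qed.

Lemma ext_set0 : ext_set set0 = set0 :> set (vertex ext).
Proof. by apply: ext_setP => v; rewrite ?ext_set_inl ?ext_set_inr. Qed.

Lemma ext_setI V W : ext_set (V `&` W) = ext_set V `&` ext_set W :> set (vertex ext).
Proof. by apply: ext_setP => v; rewrite /setI/= ?ext_set_inl ?ext_set_inr. Qed.

Lemma ext_setU V W : ext_set (V `|` W) = ext_set V `|` ext_set W :> set (vertex ext).
Proof. by apply: ext_setP => v; rewrite /setU/= ?ext_set_inl ?ext_set_inr. Qed.

Lemma ext_setD V W : ext_set (V `\` W) = ext_set V `\` ext_set W :> set (vertex ext).
Proof. by apply: ext_setP => v; rewrite /setD/= ?ext_set_inl ?ext_set_inr. Qed.

Lemma ext_set1 v (Sv : S v) :
  ext_set [set v] = [set inl v] `|` [set inr (SigSub (mem_set Sv))] :> set (vertex ext).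
Proof.
apply: ext_setP => u; rewrite /setU/= ?ext_set_inl ?ext_set_inr/=.
  by split=> [->|[[]|]]//; left.
split=> [uv|[//|[->]]//].
by right; congr inr; apply/val_inj.
Qed.

Lemma ext_set1_unsplit v : ~ S v -> ext_set [set v] = [set inl v] :> set (vertex ext).
Proof.
move=> Sv; apply: ext_setP => u; rewrite ?ext_set_inl ?ext_set_inr/=; first by split=> [->|[]].
split=> // uv; exfalso; apply: Sv; rewrite -uv; exact: set_mem (valP u).
Qed.

Lemma gset_ext_set V : gset V -> gset (ext_set V : set (vertex ext)).
Proof.
move: V; apply: (@gset_ind G [set V | gset (ext_set V : set (vertex ext))]).
  split=> /=.
- by rewrite ext_set0; exact: gset0.
- by move=> X Y gX gY; rewrite ext_setI; exact: gsetI.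
- by move=> X Y gX gY; rewrite ext_setU; exact: gsetU.
- by move=> X Y gX gY; rewrite ext_setD; exact: gsetD.
- move=> v; have [Sv|Sv] := pselect (S v).
    by rewrite /= (ext_set1 Sv); apply: gsetU; exact: gset1.
  by rewrite /= ext_set1_unsplit//; exact: gset1.
- by move=> e; exact: (@gset_range ext).
Qed.

Definition unprimed X : set (vertex G) := [set v | X (inl v)].

Lemma unprimed_ext V : unprimed (ext_set V) = V.
Proof. by apply/seteqP; split=> v; rewrite /unprimed/= ext_set_inl. Qed.

(** The split vertices w at which X contains exactly one of w and w'; for a set
of the form [ext_set V] there is none. *)
Definition discrepancy X : set (set_type S) :=
  [set w | ~ (X (inr w) <-> X (inl (val w)))].

Lemma discrepancy_ext V : discrepancy (ext_set V) = set0.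
Proof.
by rewrite -subset0 => w /=; apply; rewrite ext_set_inl ext_set_inr.
Qed.

(** Common to intersection, union and difference: where neither X nor Y
separates w from w', no Boolean combination of them does. *)
Lemma discrepancy_op (op : Prop -> Prop -> Prop) X Y Z :
  (forall p p' q q', (p <-> p') -> (q <-> q') -> (op p q <-> op p' q')) ->
  (forall x, Z x <-> op (X x) (Y x)) ->
  finite_set (discrepancy X) -> finite_set (discrepancy Y) ->
  finite_set (discrepancy Z).
Proof.
move=> opP ZE fX fY; apply: (@sub_finite_set _ _ (discrepancy X `|` discrepancy Y)).
  move=> w /= Zw; apply: contrapT => /not_orP[/contrapT Xw /contrapT Yw]; apply: Zw.
  by rewrite !ZE; exact: opP.
by rewrite finite_setU.
Qed.

(** The generators have at most one split vertex in their discrepancy, and set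
operations keep discrepancies finite. *)
Lemma gset_unprimed X : gset X -> gset (unprimed X) /\ finite_set (discrepancy X).
Proof.
move: X; apply: (@gset_ind ext
  [set X | gset (unprimed X) /\ finite_set (discrepancy X)]); first split=> /=.
- split; first exact: gset0.
  by apply: (@sub_finite_set _ _ set0) => // w /=; apply.
- move=> X Y [gX fX] [gY fY]; split; first exact: gsetI.
  by apply: (@discrepancy_op and _ _ _ _ _ fX fY) => [p p' q q'|x]; [tauto | reflexivity].
- move=> X Y [gX fX] [gY fY]; split; first exact: gsetU.
  by apply: (@discrepancy_op or _ _ _ _ _ fX fY) => [p p' q q'|x]; [tauto | reflexivity].
- move=> X Y [gX fX] [gY fY]; split; first exact: gsetD.
  by apply: (@discrepancy_op (fun p q => p /\ ~ q) _ _ _ _ _ fX fY) => [p p' q q'|x]; [tauto | reflexivity].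
- case=> [v|w].
    split.
      have -> : unprimed [set inl v] = [set v]; last exact: gset1.
      by apply/seteqP; split=> u /= [->].
    have [Sv|Sv] := pselect (S v).
      apply: (@sub_finite_set _ _ [set SigSub (mem_set Sv)]) => // u /= uv.
      apply: contrapT => uv'; apply: uv; split=> // -[uv]; exfalso; apply: uv'.
      exact/val_inj.
    apply: (@sub_finite_set _ _ set0) => // u /= uv; apply: uv; split=> // -[uv].
    by exfalso; apply: Sv; rewrite -uv; exact: set_mem (valP u).
  split.
    have -> : unprimed [set inr w] = set0; last exact: gset0.
    by rewrite -subset0.
  apply: (@sub_finite_set _ _ [set w]) => // u /= uw.
  by apply: contrapT => uw'; apply: uw; split=> // -[].
- move=> e; split; first by rewrite unprimed_ext; exact: gset_range.
  by rewrite discrepancy_ext; exact: finite_set0.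
Qed.

End ExtendedSets.

(** * Projections of C*(G) attached to sets of the extended ultragraph *)

Section ExtendedProjections.
Context {R : realType} {G : ultragraph} {A : cstarAlgType R}.
Variables (F : CKfamily G A) (H : set (set (vertex G))) (B : set (vertex G)).
Let S := split_vertices H B.
Let ext := extended H B.
Implicit Types (V W : set (vertex G)) (X Y : set (vertex ext)) (w : set_type S).

Lemma split_surviving_finite w : finite_set (surviving_edges H (val w)).
Proof. by have [[_ fin _] _] := set_mem (valP w). Qed.

Definition primed_coef X w : R[i] :=
  (`[< X (inr w) >])%:R - (`[< X (inl (val w)) >])%:R.

(** g_w plays the part of p_(w'): starting from p_V with V the trace of X on the
old vertices, which carries g_w exactly when w is in V, one adds or removes the
g_w for which X says otherwise. *)
Definition ext_projection X : A := ck_p F (unprimed X) +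
  \sum_(w \in [set: set_type S]) primed_coef X w *: gap_projection F H (val w).

Lemma primed_coef_eq0 X w : ~ discrepancy X w -> primed_coef X w = 0.
Proof.
move=> /contrapT Xw; rewrite /primed_coef; apply/eqP; rewrite subr_eq0; apply/eqP.
by congr (nat_of_bool _)%:R; apply: asbool_equiv_eq.
Qed.

Lemma ext_projectionE X (s : {fset set_type S}) :
  discrepancy X `<=` [set` s] ->
  ext_projection X = ck_p F (unprimed X) +
    \sum_(w <- s) primed_coef X w *: gap_projection F H (val w).
Proof.
move=> Xs; rewrite /ext_projection (fsbigTE s)// => w ws.
by rewrite primed_coef_eq0 ?scale0r// => /Xs /=; exact/negP.
Qed.

(** One finite index set for everything built from X and Y, so that the sums can
be compared term by term. *)
Lemma ext_projection_common X Y : gset X -> gset Y ->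
  exists s : {fset set_type S}, forall Z,
    discrepancy Z `<=` discrepancy X `|` discrepancy Y ->
    ext_projection Z = ck_p F (unprimed Z) +
      \sum_(w <- s) primed_coef Z w *: gap_projection F H (val w).
Proof.
move=> /gset_unprimed[_ fX] /gset_unprimed[_ fY].
exists (fset_set (discrepancy X `|` discrepancy Y)) => Z Zs.
by apply: ext_projectionE; rewrite fset_setK ?finite_setU.
Qed.

Let discrepancyI X Y :
  discrepancy (X `&` Y) `<=` discrepancy X `|` discrepancy Y.
Proof.
move=> w /= XYw; apply: contrapT => /not_orP[/contrapT Xw /contrapT Yw].
by apply: XYw; rewrite /setI/=; tauto.
Qed.

Let discrepancyU X Y :
  discrepancy (X `|` Y) `<=` discrepancy X `|` discrepancy Y.
Proof.
move=> w /= XYw; apply: contrapT => /not_orP[/contrapT Xw /contrapT Yw].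
by apply: XYw; rewrite /setU/=; tauto.
Qed.

Let ck_p_gapZ V w : gset V -> ck_p F V ** gap_projection F H (val w) =
  (`[< V (val w) >])%:R *: gap_projection F H (val w).
Proof.
move=> gV; rewrite ck_p_gap//; last exact: split_surviving_finite.
by case: ifP; rewrite ?scale1r ?scale0r.
Qed.

Let gap_ck_pZ V w : gset V -> gap_projection F H (val w) ** ck_p F V =
  (`[< V (val w) >])%:R *: gap_projection F H (val w).
Proof.
move=> gV; rewrite gap_ck_p//; last exact: split_surviving_finite.
by case: ifP; rewrite ?scale1r ?scale0r.
Qed.

(** Since p_V g_w = [w in V] g_w and the g_w are orthogonal, comparing the
coefficients of g_w reduces to xy - ab = (x - a) b + a (y - b) + (x - a)(y - b),
where x, y say whether w' is in X, Y and a, b whether w is. *)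
Lemma ext_projectionI X Y : gset X -> gset Y ->
  ext_projection (X `&` Y) = ext_projection X ** ext_projection Y.
Proof.
move=> gX gY; have [s sE] := ext_projection_common gX gY.
have [gX' _] := gset_unprimed gX; have [gY' _] := gset_unprimed gY.
rewrite !sE//.
rewrite amulDl !amulDr ck_setI// -[RHS]addrA; congr (_ + _).
rewrite !amul_suml amul_sumr -!big_split/=; apply: eq_big_seq => w ws.
rewrite amul_sumr (bigD1_seq w) ?fset_uniq//= big1 ?addr0; last first.
  move=> u uw; rewrite amulZl amulZr gap_orthogonal ?scaler0//;
    try exact: split_surviving_finite.
  by move=> /val_inj wu; move: uw; rewrite wu eqxx.
rewrite !(amulZl, amulZr) ck_p_gapZ// gap_ck_pZ//.
have [_ ->] := gap_projection_projection F (split_surviving_finite w).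
rewrite !scalerA -!scalerDl; congr (_ *: _).
rewrite /primed_coef /unprimed /setI/= !asbool_and.
by case: `[< X (inr w) >]; case: `[< X (inl (val w)) >]; case: `[< Y (inr w) >];
   case: `[< Y (inl (val w)) >] => /=; ring.
Qed.

Lemma ext_projectionU X Y : gset X -> gset Y ->
  ext_projection (X `|` Y) =
  ext_projection X + ext_projection Y - ext_projection (X `&` Y).
Proof.
move=> gX gY; have [s sE] := ext_projection_common gX gY.
have [gX' _] := gset_unprimed gX; have [gY' _] := gset_unprimed gY.
rewrite !sE//.
rewrite (ck_setU F gX' gY') (addrACA (ck_p F (unprimed X))) opprD [RHS]addrACA; congr (_ + _).
rewrite -sumrN -!big_split/=; apply: eq_bigr => w _.
rewrite -scalerDl -scaleNr -scalerDl; congr (_ *: _).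
rewrite /primed_coef /setI /setU/= !asbool_and !asbool_or.
by case: `[< X (inr w) >]; case: `[< X (inl (val w)) >]; case: `[< Y (inr w) >];
   case: `[< Y (inl (val w)) >] => /=; ring.
Qed.

Lemma ext_projection_ext V : ext_projection (ext_set V) = ck_p F V.
Proof.
rewrite (@ext_projectionE _ fset0) ?discrepancy_ext//.
by rewrite big_seq_fset0 addr0 unprimed_ext.
Qed.

Lemma ext_projection_projection X : gset X -> projection (ext_projection X).
Proof.
move=> gX; split; last by rewrite -ext_projectionI// setIid.
have [s sE] := ext_projection_common gX gX; rewrite sE ?setUid//.
have [gX' _] := gset_unprimed gX.
rewrite starD (ck_projection F gX').1 star_sum; congr (_ + _); apply: eq_bigr => w _.
have [gg _] := gap_projection_projection F (split_surviving_finite w).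
rewrite starZ gg; congr (_ *: _).
rewrite (_ : primed_coef X w =
    ((`[< X (inr w) >])%:R - (`[< X (inl (val w)) >])%:R : R)%:C%C) ?conj_real//.
by rewrite rmorphB !rmorph_nat.
Qed.

Lemma ext_projection_primed w :
  ext_projection [set inr w] = gap_projection F H (val w).
Proof.
rewrite (@ext_projectionE _ [fset w]%fset); last first.
  move=> u /= Hu; rewrite inE; apply/eqP; apply: contrapT => uw.
  by apply: Hu; split=> // -[].
rewrite big_seq_fset1 (_ : unprimed _ = set0); last by rewrite -subset0.
by rewrite ck_set0 add0r /primed_coef asboolT// asboolF// subr0 scale1r.
Qed.

Lemma ext_projection_split v : S v ->
  ext_projection [set inl v] = ck_p F [set v] - gap_projection F H v.
Proof.
move=> Sv; have gl := @gset1 ext (inl v); have gr := @gset1 ext (inr (SigSub (mem_set Sv))).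
have := ext_projectionU gl gr.
rewrite -(ext_set1 Sv) ext_projection_ext => ->.
rewrite ext_projection_primed (_ : _ `&` _ = set0); last by rewrite -subset0 => x [->].
by rewrite -ext_set0 ext_projection_ext ck_set0 subr0 addrK.
Qed.

End ExtendedProjections.

(** * Classes of sets modulo H *)

Section QuotientClasses.
Variables (G : ultragraph) (H : set (set (vertex G))) (B : set (vertex G)).
Hypothesis adm : admissible H B.
Let S := split_vertices H B.
Let ext := extended H B.
Implicit Types (V W : set (vertex G)) (X Y Z : set (vertex ext)).

Lemma adm_gset V : H V -> gset V.
Proof. by have [+ _ _ _ _] := adm; apply. Qed.

Lemma adm_vertex V v : H V -> V v -> H [set v].
Proof.
have [_ _ [_ _ Hsub] _ _] := adm => HV Vv.
by apply: (Hsub _ _ HV (gset1 v)) => u ->.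
Qed.

(** A breaking vertex emits an edge whose range is outside H, and H is
hereditary. *)
Lemma split_notin w : S w -> ~ H [set w].
Proof.
have [_ _ [Hr _ _] _ _] := adm.
by move=> [[_ _ [e [ew er]]] _] Hw; apply: er; apply: Hr; rewrite ew.
Qed.

Lemma ext_H_ext_set V : @ext_H G H B (ext_set V) <-> H V.
Proof.
split=> [[W HW WV]|HV]; last by exists V.
by rewrite -(unprimed_ext H B V) -WV unprimed_ext.
Qed.

Lemma qedgesE e : qedges H B e <-> ~ H (range e).
Proof. by split=> He /(ext_H_ext_set (range e)); exact: He. Qed.

(** Only edges with range in H start at a new vertex. *)
Lemma qedge_source e : qedges H B e -> ext_source H B e = inl (source e).
Proof. by move=> /qedgesE He; rewrite /ext_source; case: pselect => // -[]. Qed.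

Lemma qequiv_refl X : @qequiv G H B X X.
Proof. by have [_ H0 _ _ _] := adm; exists (ext_set set0) => //; apply/ext_H_ext_set. Qed.

Lemma qequiv_sym X Y : @qequiv G H B X Y -> @qequiv G H B Y X.
Proof. by move=> [V HV XY]; exists V. Qed.

Lemma qequiv_trans X Y Z :
  @qequiv G H B X Y -> @qequiv G H B Y Z -> @qequiv G H B X Z.
Proof.
have [_ _ [_ HU _] _ _] := adm.
move=> [_ [V HV <-] XY] [_ [W HW <-] YZ]; exists (ext_set (V `|` W)).
  by apply/ext_H_ext_set; exact: HU.
by rewrite ext_setU setUA XY setUAC YZ setUAC setUA.
Qed.

Lemma qclass_eq X Y : @qequiv G H B X Y -> qclass X = qclass Y.
Proof.
move=> XY; apply/seteqP; split=> Z [gZ XZ]; split=> //; apply: qequiv_trans XZ => //.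
exact: qequiv_sym.
Qed.

Lemma qclass_eqP X Y : gset Y -> @qclass G H B X = qclass Y -> @qequiv G H B X Y.
Proof.
by move=> gY XY; have [] : qclass X Y by rewrite XY; split=> //; exact: qequiv_refl.
Qed.

Lemma qclass_ext_H V : H V -> @qclass G H B (ext_set V) = qclass set0.
Proof.
move=> HV; apply: qclass_eq; exists (ext_set V); first exact/ext_H_ext_set.
by rewrite setUid set0U.
Qed.

Lemma qclass_inl_inj u v : ~ H [set v] ->
  @qclass G H B [set inl u] = qclass [set inl v] -> u = v.
Proof.
move=> Hv /(qclass_eqP (@gset1 ext (inl v)))[_ [V HV <-] E].
have : ([set inl v] `|` ext_set V : set (vertex ext)) (inl v) by left.
rewrite -E => -[[]//|/ext_set_inl Vv].
by exfalso; apply: Hv; exact: adm_vertex Vv.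
Qed.

Lemma qclass_inl_inr u (w : set_type S) :
  @qclass G H B [set inl u] <> qclass [set inr w].
Proof.
move=> /(qclass_eqP (@gset1 ext (inr w)))[_ [V HV <-] E].
have : ([set inr w] `|` ext_set V : set (vertex ext)) (inr w) by left.
rewrite -E => -[//|/ext_set_inr Vw].
by apply: (split_notin (set_mem (valP w))); exact: adm_vertex Vw.
Qed.

Lemma qout_edges_inl v : ~ H [set v] ->
  qout_edges (@qclass G H B [set inl v]) = surviving_edges H v.
Proof.
move=> Hv; apply/seteqP; split=> e.
  move=> [He]; rewrite /qsource qedge_source// => /qclass_inl_inj ev.
  by split; [exact: ev | exact/qedgesE].
move=> [ev er]; have He : qedges H B e by exact/qedgesE.
by split=> //; rewrite /qsource qedge_source// ev.
Qed.

Lemma qout_edges_inr (w : set_type S) :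
  qout_edges (@qclass G H B [set inr w]) = set0.
Proof.
rewrite -subset0 => e [He]; rewrite /qsource qedge_source//.
exact: qclass_inl_inr.
Qed.

End QuotientClasses.

(** * The representation of G/(H,B) in the quotient algebra *)

Section QuotientRepresentation.
Context {R : realType} {G : ultragraph} {A : cstarAlgType R}.
Variables (F : CKfamily G A) (H : set (set (vertex G))) (B : set (vertex G)).
Hypothesis adm : admissible H B.
Let S := split_vertices H B.
Let ext := extended H B.
Let J := admissible_ideal F H B.
Implicit Types (V W : set (vertex G)) (X Y Z : set (vertex ext)).

Let hJ : star_hom (qproj J) := qproj_star_hom J.
Let homD := star_homD hJ.
Let homB := star_homB hJ.
Let homM x y : qproj J (x ** y) = qproj J x ** qproj J y.
Proof. by have [_ ->] := hJ. Qed.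
Let homS x : qproj J x^# = (qproj J x)^#.
Proof. by have [_ _ ->] := hJ. Qed.

Lemma qproj_eq0 x : sideal_set J x -> qproj J x = 0.
Proof. by move=> Jx; rewrite -(star_hom0 hJ); apply/qproj_eqP; rewrite subr0. Qed.

Lemma qproj_ck_p V : H V -> qproj J (ck_p F V) = 0.
Proof.
move=> HV; apply: qproj_eq0; apply: sub_gen_smallest; left; exists V => //.
by split=> //; exact: adm_gset adm _ HV.
Qed.

Lemma qproj_gap w : B w -> qproj J (gap_projection F H w) = 0.
Proof.
by move=> Bw; apply: qproj_eq0; apply: sub_gen_smallest; right; exists w.
Qed.

(** s_e = s_e p_(r(e)), and p_(r(e)) lies in the ideal. *)
Lemma qproj_ck_s e : H (range e) -> qproj J (ck_s F e) = 0.
Proof.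
move=> He; rewrite -(ck_partial_isometry F e) -amulA ck_range homM.
by rewrite qproj_ck_p// amulx0.
Qed.

(** For V in H, adding V to X changes P_X by p_V - P_X p_V, which lies in the
ideal. *)
Lemma qproj_ext_projection X Y : gset X -> gset Y -> @qequiv G H B X Y ->
  qproj J (ext_projection F X) = qproj J (ext_projection F Y).
Proof.
have absorb Z V : gset Z -> H V ->
    qproj J (ext_projection F (Z `|` ext_set V)) = qproj J (ext_projection F Z).
  move=> gZ HV; have gV := @gset_ext_set G H B V (adm_gset adm HV).
  rewrite ext_projectionU// ext_projectionI// ext_projection_ext homB homD homM.
  by rewrite qproj_ck_p// amulx0 addr0 subr0.
by move=> gX gY [_ [V HV <-] XY]; rewrite -(absorb X V)// XY absorb.
Qed.

(** A class is sent to the image of P_X for a chosen representative X; the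
default value of the choice is never met on classes of sets ([quotient_qE]). *)
Definition quotient_q (c : set (set (vertex ext))) : quotient J :=
  qproj J (ext_projection F (xget set0 [set X | @gset ext X /\ qclass X = c])).

Lemma quotient_qE X : gset X ->
  quotient_q (qclass X) = qproj J (ext_projection F X).
Proof.
move=> gX; rewrite /quotient_q; case: xgetP => [Y -> [gY YX]|/(_ X)[]//].
by apply: qproj_ext_projection => //; exact: qclass_eqP YX.
Qed.

(** Three cases. If v is split, P_v = p_v - g_v is the sum by definition of the
gap. If v is in B, then g_v is in the ideal. Otherwise v is not a breaking
vertex, hence it is regular, and the edges with range in H contribute 0. *)
Lemma qproj_vertex v : finite_set (surviving_edges H v) ->
  surviving_edges H v !=set0 ->
  qproj J (ext_projection F ([set inl v] : set (vertex ext))) =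
  \sum_(e \in surviving_edges H v) range_projection (qproj J (ck_s F e)).
Proof.
move=> fin ne.
have -> : \sum_(e \in surviving_edges H v) range_projection (qproj J (ck_s F e)) =
    qproj J (\sum_(e \in surviving_edges H v) range_projection (ck_s F e)).
  rewrite !fsbig_finite// (star_hom_sum _ _ hJ); apply: eq_bigr => e _.
  by rewrite homM homS.
have [Sv|Sv] := pselect (S v).
  by rewrite ext_projection_split// /gap_projection opprB addrC subrK.
rewrite -ext_set1_unsplit// ext_projection_ext.
have [Bv|Bv] := pselect (B v).
  by apply/eqP; rewrite -subr_eq0 -homB -[_ - _]/(gap_projection F H v) qproj_gap.
have fo : finite_set (out_edges v).
  by apply: contrapT => io; apply: Sv; split.
have rv : regular v by split=> //; have [e [ev _]] := ne; exists e.
rewrite (ck_sum F rv) (fsbigID (surviving_edges H v))//.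
have -> : out_edges v `&` surviving_edges H v = surviving_edges H v.
  by apply/setIidr => e [].
suff R0 : qproj J (\sum_(e \in out_edges v `&` ~` surviving_edges H v)
    range_projection (ck_s F e)) = 0 by rewrite homD R0 addr0.
have fD : finite_set (out_edges v `&` ~` surviving_edges H v).
  by apply: sub_finite_set fo => e [].
rewrite fsbig_finite// (star_hom_sum _ _ hJ) big1_seq// => e /andP[_].
rewrite in_fset_set// inE => -[ev /= /not_andP[//|/contrapT er]].
by rewrite homM qproj_ck_s// amul0x.
Qed.

Definition quotient_representation : qrepresentation H B (quotient J).
Proof.
apply: (@Build_qrepresentation _ _ _ _ _ (fun e => qproj J (ck_s F e)) quotient_q).
- move=> e _; have := congr1 (qproj J) (ck_partial_isometry F e).
  by rewrite !homM homS.
- move=> _ [X gX <-]; rewrite quotient_qE//.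
  have [ps pp] := ext_projection_projection F gX.
  by split; [rewrite -{2}ps homS | rewrite -{3}pp homM].
- rewrite quotient_qE; last exact: gset0.
  by rewrite -ext_set0 ext_projection_ext ck_set0 (star_hom0 hJ).
- move=> X Y gX gY; rewrite !quotient_qE//; last exact: gsetI.
  by rewrite ext_projectionI.
- move=> X Y gX gY; rewrite !quotient_qE//; [|exact: gsetI|exact: gsetU].
  by rewrite ext_projectionU// homB homD.
- move=> e He; rewrite /qrange quotient_qE; last exact: (@gset_range ext).
  by rewrite ext_projection_ext -ck_range homM homS.
- move=> e f _ _ ef; have := congr1 (qproj J) (ck_edge_orthogonal F ef).
  by rewrite homM homS (star_hom0 hJ).
- move=> e He; rewrite /qsource quotient_qE; last exact: (@gset1 ext).
  rewrite qedge_source//.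
  suff E : range_projection (ck_s F e) **
      ext_projection F ([set inl (source e)] : set (vertex ext)) =
      range_projection (ck_s F e).
    by have := congr1 (qproj J) E; rewrite !homM homS.
  have [Se|Se] := pselect (S (source e)); last first.
    by rewrite -ext_set1_unsplit// ext_projection_ext; exact: ck_source.
  have [[_ fin _] _] := Se.
  rewrite ext_projection_split// /gap_projection opprB addrC subrK fsbig_finite//.
  by apply: range_projection_sum => //; split=> //; exact/(qedgesE H B).
- move=> _ [[v Hv <-]|[w _ <-]].
    rewrite qout_edges_inl// => fin ne.
    by rewrite quotient_qE ?qproj_vertex//; exact: (@gset1 ext).
  by rewrite qout_edges_inr// => _ [].
Defined.

End QuotientRepresentation.

(** * The Cuntz-Krieger family in C*(G/(H,B)) *)

Section InducedFamily.
Context {R : realType} {G : ultragraph} {D : cstarAlgType R}.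
Variables (H : set (set (vertex G))) (B : set (vertex G)).
Variable T : qrepresentation H B D.
Hypothesis adm : admissible H B.
Let S := split_vertices H B.
Let ext := extended H B.
Implicit Types (V W : set (vertex G)) (X Y : set (vertex ext)).

Let q X : D := qr_q T (qclass X).

Definition induced_s (e : edge G) : D :=
  if `[< H (range e) >] then 0 else qr_t T e.

Lemma induced_sH e : H (range e) -> induced_s e = 0.
Proof. by move=> He; rewrite /induced_s asboolT. Qed.

Lemma induced_sN e : ~ H (range e) -> induced_s e = qr_t T e.
Proof. by move=> He; rewrite /induced_s asboolF. Qed.

Lemma q_ext_H V : H V -> q (ext_set V) = 0.
Proof. by move=> HV; rewrite /q (qclass_ext_H adm HV) qr_set0. Qed.

Lemma q_vertex v : ~ H [set v] -> finite_set (surviving_edges H v) ->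
  surviving_edges H v !=set0 ->
  q [set inl v] =
  \sum_(e \in surviving_edges H v) range_projection (induced_s e).
Proof.
move=> Hv fin ne; rewrite /q qr_sum ?qout_edges_inl//; last by left; exists v.
by apply: eq_fsbigr => e /set_mem[_ er]; rewrite induced_sN.
Qed.

(** The relation at a regular vertex v splits in two. If v is in H, all its edges
end in H and both sides vanish. If not, saturation gives an edge of v that
survives, so the relation at the class of v holds in G/(H,B). *)
Definition induced_family : CKfamily G D.
Proof.
apply: (@Build_CKfamily _ _ _ induced_s (fun V => q (ext_set V))).
- move=> e; have [He|He] := pselect (H (range e)).
    by rewrite induced_sH// /partial_isometry amulx0.
  by rewrite induced_sN//; apply: qr_partial_isometry; exact/(qedgesE H B).
- move=> e f ef; rewrite /range_projection.
  have [He|He] := pselect (H (range e)); first by rewrite induced_sH// !amul0x.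
  have [Hf|Hf] := pselect (H (range f)).
    by rewrite (induced_sH Hf) !amul0x amulx0.
  rewrite !induced_sN// amulA -(amulA (qr_t T e)) (qr_orthogonal T)//.
  + by rewrite amulx0 amul0x.
  + exact/(qedgesE H B).
  + exact/(qedgesE H B).
- by move=> V gV; apply: qr_projection; exists (ext_set V) => //; exact: gset_ext_set.
- by rewrite ext_set0 /q qr_set0.
- by move=> V W gV gW; rewrite ext_setI /q qr_setI//; exact: gset_ext_set.
- move=> V W gV gW; rewrite ext_setU ext_setI /q qr_setU//; exact: gset_ext_set.
- move=> e; have [He|He] := pselect (H (range e)).
    by rewrite induced_sH// amulx0 q_ext_H.
  by rewrite induced_sN// (qr_range T)//; exact/(qedgesE H B).
- move=> e; have [He|He] := pselect (H (range e)).
    by rewrite induced_sH// /range_projection amul0x /subprojection amul0x.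
  have qe : qedges H B e by exact/(qedgesE H B).
  have := qr_source T qe; rewrite induced_sN// /subprojection.
  rewrite /qsource qedge_source// => rE; rewrite -{1}rE -amulA -qr_setI.
  + have -> : [set inl (source e)] `&` ext_set [set source e] =
        [set inl (source e)] :> set (vertex ext); last by [].
    by apply/setIidl => x ->; apply/ext_set_inl.
  + exact: (@gset1 ext).
  + by apply: gset_ext_set; exact: gset1.
- move=> v [fo ne].
  have [_ _ [Hr _ _] Hs _] := adm.
  have [Hv|Hv] := pselect (H [set v]).
    rewrite q_ext_H// fsbig1// => e /= ev.
    by rewrite induced_sH ?/range_projection ?amul0x//; apply: Hr; rewrite ev.
  have nS : ~ S v by move=> [[]].
  have sub : surviving_edges H v `<=` out_edges v by move=> e [].
  rewrite ext_set1_unsplit// q_vertex//.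
  + apply: fsbig_widen => // e [ev /= /not_andP[//|/contrapT er]].
    by rewrite induced_sH// /range_projection amul0x.
  + exact: sub_finite_set sub fo.
  + apply: contrapT => /set0P/negP/negPn/eqP E; apply: Hv; apply: Hs => // e ev.
    by apply: contrapT => er; have : surviving_edges H v e by []; rewrite E.
Defined.

End InducedFamily.

Section Valuation.
Variables (G : ultragraph) (V : zmodType) (f : set (vertex G) -> V).
Hypothesis f0 : f set0 = 0.
Hypothesis fU : forall X Y, gset X -> gset Y ->
  f (X `|` Y) = f X + f Y - f (X `&` Y).

Lemma valuationU X Y : gset X -> gset Y -> X `&` Y = set0 ->
  f (X `|` Y) = f X + f Y.
Proof. by move=> gX gY XY; rewrite fU// XY f0 subr0. Qed.

Lemma valuationD X Y : gset X -> gset Y -> f (X `\` Y) = f X - f (X `&` Y).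
Proof.
move=> gX gY; rewrite -[in f X](setUIDK X Y) setUC valuationU ?addrK//.
- exact: gsetD.
- exact: gsetI.
- by rewrite -subset0 => x [[_ nY] [_ /nY]].
Qed.

End Valuation.

(** * The isomorphism *)

Section Isomorphism.
Context {R : realType} {G : ultragraph} {A D : cstarAlgType R}.
Variables (H : set (set (vertex G))) (B : set (vertex G)).
Variables (F : CKfamily G A) (T : qrepresentation H B D).
Hypothesis adm : admissible H B.
Let S := split_vertices H B.
Let ext := extended H B.
Let J := admissible_ideal F H B.
Let q (X : set (vertex ext)) : D := qr_q T (qclass X).

Variable pi : A -> D.
Hypothesis hpi : star_hom pi.
Hypothesis pi_s : forall e, pi (ck_s F e) = ck_s (induced_family T adm) e.
Hypothesis pi_p : forall V, gset V -> pi (ck_p F V) = ck_p (induced_family T adm) V.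

Let qU X Y : gset X -> gset Y -> q (X `|` Y) = q X + q Y - q (X `&` Y).
Proof. exact: qr_setU. Qed.

Let q0 : q set0 = 0.
Proof. exact: qr_set0. Qed.

(** The surviving edges of w are those of the class of w in G/(H,B), whose sum is
the projection of that class. *)
Lemma pi_gap w : breaking H w ->
  pi (gap_projection F H w) = q (ext_set [set w]) - q [set inl w].
Proof.
have [_ _ [Hr _ _] _ _] := adm.
move=> [_ fin ne]; have Hw : ~ H [set w].
  by move=> Hw; have [e [ew er]] := ne; apply: er; apply: Hr; rewrite ew.
rewrite /gap_projection (star_homB hpi) pi_p; last exact: gset1.
congr (_ - _); rewrite /q (q_vertex T adm)// !fsbig_finite// (star_hom_sum _ _ hpi).
apply: eq_bigr => e _; have [_ piM piS] := hpi.
by rewrite /range_projection piM piS pi_s.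
Qed.

(** For w in B there is no new vertex w', so [pi_gap] gives 0. *)
Lemma pi_kernel x : sideal_set J x -> pi x = 0.
Proof.
apply: (smallest_sub (star_hom_kernel hpi)) => _ [[V [HV gV] <-]|[w Bw <-]] /=.
  by rewrite pi_p//; exact: q_ext_H.
have [_ _ _ _ BH] := adm.
by rewrite pi_gap ?ext_set1_unsplit ?subrr//; [move=> [_] | exact: BH].
Qed.

(** Both sides respect the set operations, so it is enough to compare them on
vertices and ranges; the new vertices are handled by [pi_gap]. *)
Lemma pi_ext_projection X : gset X -> pi (ext_projection F X) = q X.
Proof.
have P0 : ext_projection F (set0 : set (vertex ext)) = 0.
  by rewrite -ext_set0 ext_projection_ext ck_set0.
have PU (Y Z : set (vertex ext)) : gset Y -> gset Z -> ext_projection F (Y `|` Z) =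
    ext_projection F Y + ext_projection F Z - ext_projection F (Y `&` Z).
  exact: ext_projectionU.
have [_ piM _] := hpi.
move=> gX; suff : gset X /\ pi (ext_projection F X) = q X by case.
apply: (@gset_ind ext
  [set Z | gset Z /\ pi (ext_projection F Z) = q Z]) gX; first split=> /=.
- by split; [exact: gset0 | rewrite P0 (star_hom0 hpi) q0].
- move=> Y Z [gY EY] [gZ EZ]; split; first exact: gsetI.
  by rewrite ext_projectionI// piM EY EZ /q qr_setI.
- move=> Y Z [gY EY] [gZ EZ]; split; first exact: gsetU.
  rewrite PU// (star_homB hpi) (star_homD hpi) EY EZ qU//.
  by rewrite ext_projectionI// piM EY EZ /q qr_setI.
- move=> Y Z [gY EY] [gZ EZ]; split; first exact: gsetD.
  rewrite (valuationD P0 PU)// (valuationD q0 qU)// (star_homB hpi) EY.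
  by rewrite ext_projectionI// piM EY EZ /q qr_setI.
- case=> [v|w] /=; split; try exact: (@gset1 ext).
    have [Sv|Sv] := pselect (S v).
      rewrite ext_projection_split// (star_homB hpi) pi_p; last exact: gset1.
      by rewrite pi_gap; [rewrite subKr | have [] := Sv].
    rewrite -ext_set1_unsplit// ext_projection_ext pi_p//; exact: gset1.
  have Sw := set_mem (valP w); have [bw _] := Sw.
  rewrite ext_projection_primed pi_gap// (ext_set1 Sw) (valuationU q0 qU).
  + by rewrite addrC addKr; congr (q [set inr _]); apply/val_inj.
  + exact: (@gset1 ext).
  + exact: (@gset1 ext).
  + by rewrite -subset0 => x [->].
- move=> e /=; split; first exact: (@gset_range ext).
  by rewrite ext_projection_ext pi_p//; exact: gset_range.
Qed.

End Isomorphism.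

Theorem proposition4p6 (R : realType) (G : ultragraph)
  (H : set (set (vertex G))) (B : set (vertex G))
  (A : cstarAlgType R) (F : CKfamily G A)
  (D : cstarAlgType R) (T : qrepresentation H B D) :
  admissible H B ->
  universal_CKfamily F ->
  universal_qrepresentation T ->
  cstar_isomorphic_quotient D (admissible_ideal F H B).
Proof.
move=> adm [genF univF] [genT univT].
set J := admissible_ideal F H B.
have [pi [hpi pi_s pi_p]] := univF D (induced_family T adm).
have [psi [hpsi psi_t psi_q]] := univT (quotient J) (quotient_representation F adm).
have [lpi piM piS] := hpi; have [lpsi psiM psiS] := hpsi.
have hJ := qproj_star_hom J; have [lJ JM JS] := hJ.
have piJ := pi_kernel hpi pi_s pi_p.
(* the factorization of pi through the quotient *)
pose pibar (u : quotient J) : D := pi (repr u).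
have pibarE x : pibar (qproj J x) = pi x.
  apply/eqP; rewrite -subr_eq0 -(star_homB hpi); apply/eqP; apply: piJ.
  exact: repr_qproj.
have hpibar : star_hom pibar.
  split=> [k u v|u v|u].
  - have [x <-] := qproj_surj u; have [y <-] := qproj_surj v.
    by rewrite -lJ !pibarE lpi.
  - have [x <-] := qproj_surj u; have [y <-] := qproj_surj v.
    by rewrite -JM !pibarE piM.
  - by have [x <-] := qproj_surj u; rewrite -JS !pibarE piS.
have pibar_psi : cancel psi pibar.
  have hc : star_hom (pibar \o psi).
    have [lp pM pS] := hpibar; split=> [k x y|x y|x] /=.
    - by rewrite lpsi lp.
    - by rewrite psiM pM.
    - by rewrite psiS pS.
  have hid : star_hom (@id D) by split.
  apply: (eq_on_generators hc hid genT) => _ [[e qe <-]|[_ [X gX <-] <-]] /=.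
    rewrite psi_t//= pibarE pi_s/= induced_sN//; exact/(qedgesE H B).
  rewrite psi_q /=; last by exists X.
  by rewrite quotient_qE// pibarE (pi_ext_projection hpi pi_s pi_p).
have psi_pi : psi \o pi =1 qproj J.
  have hc : star_hom (psi \o pi).
    by split=> [k x y|x y|x] /=; rewrite ?lpi ?lpsi ?piM ?psiM ?piS ?psiS.
  apply: (eq_on_generators hc hJ genF) => _ [[e _ <-]|[V gV <-]] /=.
    rewrite pi_s/=; have [He|He] := pselect (H (range e)).
      by rewrite induced_sH// (star_hom0 hpsi) qproj_ck_s.
    by rewrite induced_sN// psi_t//; exact/(qedgesE H B).
  have gV' := @gset_ext_set G H B V gV.
  rewrite pi_p//= psi_q/=; last by exists (ext_set V).
  by rewrite quotient_qE// ext_projection_ext.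
have psi_pibar : cancel pibar psi.
  by move=> u; have [x <-] := qproj_surj u; rewrite pibarE -[LHS]/((psi \o pi) x) psi_pi.
exists psi; split=> //; first by exists pibar.
(* both inverse maps are contractive, hence isometric *)
move=> x; rewrite rnormE; congr (_%:C%C); apply/eqP; rewrite eq_le -rnorm_quotient.
rewrite (star_hom_contractive hpsi) andbT -{1}(pibar_psi x).
exact: star_hom_contractive hpibar _.
Qed.
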